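(* Consider the Gaussian side-channel assisted three-node full-duplex network described in the context, with capacity region $\mathcal C$, and the regions $\mathcal R_{\rm DC}$ and $\mathcal R_{\rm EC}$ defined in the context. (1) If $W\ge 1$ and $\mathrm{SNR}_{\rm side}\ge \mathrm{SNR}_2$, then $\mathcal R_{\rm DC}$ is within $\tfrac12$ bit/s/Hz of $\mathcal C$: for every $(R_1,R_2)\in\mathcal C$, $\big(R_1-\tfrac12(W_m+W_s),\,R_2-\tfrac12(W_m+W_s)\big)\in\mathcal R_{\rm DC}$. (2) If $W$ is a positive integer and $\mathrm{SNR}_{\rm side}\ge\left(1+\frac{2}{\sqrt2-1}\right)(\mathrm{INR}-2)$, then $\mathcal R_{\rm EC}$ is within $\tfrac12$ bit/s/Hz of $\mathcal C$: for every $(R_1,R_2)\in\mathcal C$, $\big(R_1-\tfrac12(W_m+W_s),\,R_2-\tfrac12(W_m+W_s)\big)\in\mathcal R_{\rm EC}$.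
   Context: Gaussian side-channel assisted three-node full-duplex network: a full-duplex base station (BS) sends a downlink message $S_1$ at rate $R_1$ to a half-duplex mobile M2, while a half-duplex mobile M1 sends an uplink message $S_2$ at rate $R_2$ to BS. The main channel has bandwidth $W_m$; an orthogonal wireless side-channel from M1 to M2 has bandwidth $W_s$, and $W=W_s/W_m$. The real-valued input–output relations are $Y_1=\gamma_1X_1+\gamma^m_{21}X_2+Z_1$ (received by M2), $Y_2=\gamma_2X_2+Z_2$ (received by BS), $Y_3=\gamma^s_{21}X_3+Z_3$ (received by M2 on the side-channel), where $X_1$ is sent by BS, $X_2,X_3$ by M1, and $Z_i$ are mutually independent i.i.d. $\mathcal N(0,\sigma^2)$. Power constraints: $\mathbb E|X_1|^2\le P_1$, $\mathbb E|X_2+X_3|^2\le P_2$. $\mathrm{SNR}_1=|\gamma_1|^2P_1/\sigma^2$, $\mathrm{SNR}_2=|\gamma_2|^2P_2/\sigma^2$, $\mathrm{INR}=|\gamma^m_{21}|^2P_2/\sigma^2$, $\mathrm{SNR}_{\rm side}=|\gamma^s_{21}|^2P_2/\sigma^2$. Rates in bits/s, $C(x)=W_m\log_2(1+x)$, $W\,C(x/W)=W_s\log_2(1+x/W)$. M2 decodes $S_1$ from $(Y_1^n,Y_3^n)$; BS decodes $S_2$ from $Y_2^n$ and $S_1$; BS's symbol at time $i$ may depend on $(S_1,Y_2^{i-1})$. The capacity region $\mathcal C$ is the closure of the set of achievable rate pairs; gaps in bits/s/Hz are normalized by $W_m+W_s$. With $\bar\lambda=1-\lambda$: the decode-and-cancel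 region $\mathcal R_{\rm DC}$ is the union over $\lambda\in[0,1]$ of the sets $\{(R_1,R_2): R_1\le C(\mathrm{SNR}_1),\ R_2\le\min\{W C(\lambda\mathrm{SNR}_{\rm side}/W),\,C(\bar\lambda\mathrm{SNR}_2)\}\}$; the estimate-and-cancel region $\mathcal R_{\rm EC}$ is the union over $K\ge0$ of the sets $\{(R_1,R_2): R_1\le C\big(\mathrm{SNR}_1(1+\tfrac{K^2\mathrm{SNR}_{\rm side}}{(1+K)^2})/(1+\tfrac{K^2\mathrm{SNR}_{\rm side}}{(1+K)^2}+\tfrac{\mathrm{INR}}{(1+K)^2})\big),\ R_2\le C\big(\mathrm{SNR}_2/(1+K)^2\big)\}$. *)

(* Defs.v *)
From HB Require Import structures.
From mathcomp Require Import all_boot all_order all_algebra.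
From mathcomp Require Import all_classical all_reals all_analysis.
Set Implicit Arguments. Unset Strict Implicit. Unset Printing Implicit Defensive.
Import Order.TTheory GRing.Theory Num.Theory.
Import numFieldNormedType.Exports.
Local Open Scope classical_set_scope.
Local Open Scope ring_scope.

Section Defs.
Variable R : realType.

Definition log2 (x : R) : R := ln x / ln 2.
Definition capC (Wm x : R) : R := Wm * log2 (1 + x).

(* Expectation over an i.i.d. N(0, sig^2) noise vector of length k
   (sig is the standard deviation), of a nonnegative extended-real
   function, written as an iterated Lebesgue integral against the Gaussian
   density (by Tonelli this is the integral against the k-fold product
   Gaussian measure for jointly measurable integrands). *)
Fixpoint gauss_exp (sig : R) (k : nat) : (k.-tuple R -> \bar R) -> \bar R :=
  match k return (k.-tuple R -> \bar R) -> \bar R with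
  | 0 => fun f => f [tuple]
  | k'.+1 => fun f =>
      (\int[@lebesgue_measure R]_(x in setT)
         ((normal_pdf 0 sig x)%:E * gauss_exp sig (fun t => f [tuple of x :: t])))%E
  end.

(* A code of block length n (uses of the main channel) using ms uses of the
   side channel.  BS sends S1 in 'I_M1 to M2; M1 sends S2 in 'I_M2 to BS. *)
Record code (n ms : nat) := Code {
  M1 : nat;
  M2 : nat;
  encX2 : 'I_M2 -> n.-tuple R;
  encX3 : 'I_M2 -> ms.-tuple R;
  encX1 : 'I_M1 -> 'I_n -> n.-tuple R -> R;   (* BS: X1_i = encX1 S1 i Y2^n *)
  decM2 : n.-tuple R * ms.-tuple R -> 'I_M1;
  decBS : 'I_M1 -> n.-tuple R -> 'I_M2
}.
Arguments M1 {n ms} c.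
Arguments M2 {n ms} c.
Arguments encX2 {n ms} c _.
Arguments encX3 {n ms} c _.
Arguments encX1 {n ms} c _ _ _.
Arguments decM2 {n ms} c _.
Arguments decBS {n ms} c _ _.

Definition causal n ms (c : code n ms) :=
  forall s1 (i : 'I_n) (y y' : n.-tuple R),
    (forall j : 'I_n, (j < i)%N -> tnth y j = tnth y' j) ->
    encX1 c s1 i y = encX1 c s1 i y'.

Definition code_measurable n ms (c : code n ms) :=
  (forall s1 i, measurable_fun [set: n.-tuple R] (encX1 c s1 i)) /\
  (forall s1, measurable (decM2 c @^-1` [set s1])) /\
  (forall s1 s2, measurable (decBS c s1 @^-1` [set s2])).

Section Signals.
Variables (g1 g2 g21m g21s : R) (n ms : nat) (c : code n ms).
Variables (s1 : 'I_(M1 c)) (s2 : 'I_(M2 c)).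
Variables (z1 z2 : n.-tuple R) (z3 : ms.-tuple R).

Definition sigY2 : n.-tuple R :=
  [tuple g2 * tnth (encX2 c s2) i + tnth z2 i | i < n].
Definition sigX1 (i : 'I_n) : R := encX1 c s1 i sigY2.
Definition sigY1 : n.-tuple R :=
  [tuple g1 * sigX1 i + g21m * tnth (encX2 c s2) i + tnth z1 i | i < n].
Definition sigY3 : ms.-tuple R :=
  [tuple g21s * tnth (encX3 c s2) j + tnth z3 j | j < ms].

Definition err_ind : \bar R :=
  if (decM2 c (sigY1, sigY3) != s1) || (decBS c s1 sigY2 != s2) then 1%E else 0%E.
Definition pow1 : \bar R := (\sum_(i < n) sigX1 i ^+ 2)%:E.
End Signals.


Definition noise_exp (sig : R) n ms
    (f : n.-tuple R -> n.-tuple R -> ms.-tuple R -> \bar R) : \bar R :=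
  gauss_exp sig (fun z1 => gauss_exp sig (fun z2 => gauss_exp sig (fun z3 => f z1 z2 z3))).

(* (R1, R2) (bits/s) is achievable.  Convention: the main channel of
   bandwidth Wm offers 2 Wm real uses per second and the side channel 2 Ws,
   i.e. W = Ws/Wm side uses per main use; a rate of R bits/s thus means
   R/(2 Wm) bits per main-channel use, so that C(x) = Wm log2(1+x). *)
Definition achievable (Wm Ws sig P1 P2 g1 g2 g21m g21s : R) (r : R * R) : Prop :=
  0 <= r.1 /\ 0 <= r.2 /\
  forall eps : R, 0 < eps -> exists N : nat, forall n : nat, (N <= n)%N ->
  exists ms : nat, ms%:R <= (Ws / Wm) * n%:R /\
  exists c : code n ms,
    causal c /\ code_measurable c /\
    n%:R * r.1 / (2 * Wm) <= log2 (M1 c)%:R /\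
    n%:R * r.2 / (2 * Wm) <= log2 (M2 c)%:R /\
    (\sum_(s1 < M1 c) \sum_(s2 < M2 c)
       noise_exp sig (fun z1 z2 (z3 : ms.-tuple R) => pow1 g2 s1 s2 z2) <=
       (n%:R * P1 * (M1 c)%:R * (M2 c)%:R)%:E)%E /\
    (* E|X2 + X3|^2 <= P2  (total energy of M1 over both channels) *)
    \sum_(s2 < M2 c) (\sum_(i < n) tnth (encX2 c s2) i ^+ 2 +
                     \sum_(j < ms) tnth (encX3 c s2) j ^+ 2) <=
       n%:R * P2 * (M2 c)%:R /\
    (\sum_(s1 < M1 c) \sum_(s2 < M2 c)
       noise_exp sig (fun z1 z2 z3 => err_ind g1 g2 g21m g21s s1 s2 z1 z2 z3) <=
       (eps * (M1 c)%:R * (M2 c)%:R)%:E)%E.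

Definition capacity_region (Wm Ws sig P1 P2 g1 g2 g21m g21s : R) : set (R * R) :=
  closure (achievable Wm Ws sig P1 P2 g1 g2 g21m g21s).

Definition SNR (g P sig : R) : R := g ^+ 2 * P / sig ^+ 2.

Definition R_DC (Wm Ws SNR1 SNR2 SNRs : R) : set (R * R) :=
  [set r | exists lam : R, 0 <= lam <= 1 /\
     r.1 <= capC Wm SNR1 /\
     r.2 <= Num.min ((Ws / Wm) * capC Wm (lam * SNRs / (Ws / Wm)))
                    (capC Wm ((1 - lam) * SNR2))].

Definition R_EC (Wm SNR1 SNR2 SNRs INR : R) : set (R * R) :=
  [set r | exists K : R, 0 <= K /\
     r.1 <= capC Wm (SNR1 * (1 + K ^+ 2 * SNRs / (1 + K) ^+ 2) /
                     (1 + K ^+ 2 * SNRs / (1 + K) ^+ 2 + INR / (1 + K) ^+ 2)) /\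
     r.2 <= capC Wm (SNR2 / (1 + K) ^+ 2)].

End Defs.

(* Main.v *)
Require Import Defs.
From HB Require Import structures.
From mathcomp Require Import all_boot all_order all_algebra.
From mathcomp Require Import all_classical all_reals all_analysis.
From mathcomp Require Import measurable_realfun ring lra.
Import Order.TTheory GRing.Theory Num.Theory.
Import numFieldNormedType.Exports.
Local Open Scope classical_set_scope.
Local Open Scope ring_scope.

(* Only the cut-set bounds R1 <= C(SNR1) and R2 <= C(SNR2) on the capacity
   region are needed: against them, lambda = 1/2 and K = sqrt 2 - 1 achieve the
   gap.  The bounds hold although BS hears M1 causally, because after fixing the
   M1 message and the noises Z2, Z3 the downlink is an ordinary Gaussian channel
   with deterministic codewords, and after fixing the BS message and Z1, Z3 so is
   the uplink.  For such a channel the weak converse comes from one inequality,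
   1 + u <= exp u, applied to M * dQ/dP_m on the decoding region of m and to
   dQ/dP_m elsewhere, where P_m = N(x_m, s^2 I) and Q = N(0, t^2 I) with
   t^2 = s^2 + g^2 P.  Averaging over m bounds (1 - eps) ln M by 1 plus the mean
   divergence D(P_m || Q), which is affine in the energy of the codewords, so
   averaging further over the fixed variables involves no Jensen inequality. *)

(** * Iterated Gaussian expectations *)

Section Sections.
Context d1 d2 d3 (T1 : measurableType d1) (T2 : measurableType d2)
  (T3 : measurableType d3).

Lemma measurable_fun_section1 (f : T1 * T2 -> T3) (y : T2) :
  measurable_fun setT f -> measurable_fun setT (fun x => f (x, y)).
Proof.
by move=> mf; apply: (measurableT_comp mf); exact: measurable_fun_pair.
Qed.

Lemma measurable_fun_section2 (f : T1 * T2 -> T3) (x : T1) :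
  measurable_fun setT f -> measurable_fun setT (fun y => f (x, y)).
Proof.
by move=> mf; apply: (measurableT_comp mf); exact: measurable_fun_pair.
Qed.

End Sections.

Section GaussianExpectation.
Variable R : realType.
Local Notation mu := (@lebesgue_measure R).
Local Notation pdf := (@normal_pdf R 0).
Implicit Types (s x : R) (k : nat).

Lemma normal_pdf_gt0 s x : 0 < s -> 0 < pdf s x.
Proof.
move=> s0; rewrite normal_pdfE ?gt_eqF//.
by rewrite mulr_gt0 ?expR_gt0// normal_peak_gt0// gt_eqF.
Qed.

Lemma measurable_normal_pdfM d (T : measurableType d) s (f : T * R -> \bar R) :
  measurable_fun setT f ->
  measurable_fun setT (fun p : T * R => ((pdf s p.2)%:E * f p)%E).
Proof.
move=> mf; apply: emeasurable_funM => //.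
apply/measurable_EFinP.
by apply: (measurableT_comp (measurable_normal_pdf 0 s)).
Qed.

(** Moves the head coordinate into the parameter space, which is the step that the inductions on [k]
    below repeat. *)
Lemma measurable_cons_pair d (T : measurableType d) k (f : T * k.+1.-tuple R -> \bar R) :
  measurable_fun setT f ->
  measurable_fun setT
    (fun q : (T * R) * k.-tuple R => f (q.1.1, [tuple of q.1.2 :: q.2])).
Proof.
move=> mf; apply: (measurableT_comp mf).
apply: measurable_fun_pair; first exact: measurableT_comp.
by apply: measurable_cons => //; exact: measurableT_comp.
Qed.

Lemma measurable_cons1 k x (f : k.+1.-tuple R -> \bar R) :
  measurable_fun setT f ->
  measurable_fun setT (fun t : k.-tuple R => f [tuple of x :: t]).
Proof.
move=> mf; apply: (measurableT_comp mf).
by apply: measurable_cons => //; exact: measurable_cst.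
Qed.

Lemma gauss_exp_ge0 s k (f : k.-tuple R -> \bar R) :
  (forall z, 0 <= f z)%E -> (0 <= gauss_exp s f)%E.
Proof.
elim: k f => [|k IH] f f0 /=; first exact: f0.
apply: integral_ge0 => x _; apply: mule_ge0; last exact: IH.
by rewrite lee_fin normal_pdf_ge0.
Qed.

(** The parameter space [T] is generalised in the induction: each step absorbs one noise coordinate
    into it, and Tonelli's theorem makes the integral over that coordinate measurable. *)
Lemma measurable_gauss_exp d (T : measurableType d) s k
    (f : T * k.-tuple R -> \bar R) :
  measurable_fun setT f -> (forall p, 0 <= f p)%E ->
  measurable_fun setT (fun t => gauss_exp s (fun z => f (t, z))).
Proof.
elim: k d T f => [|k IH] d T f mf f0 /=.
  by apply: (measurableT_comp mf); exact: measurable_fun_pair.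
pose g (p : T * R) := ((pdf s p.2)%:E *
  gauss_exp s (fun z => f (p.1, [tuple of p.2 :: z])))%E.
have mg : measurable_fun setT g.
  apply: measurable_normal_pdfM.
  apply: (IH _ _ (fun q : (T * R) * k.-tuple R => f (q.1.1, [tuple of q.1.2 :: q.2]))) => //.
  exact: measurable_cons_pair.
apply: (@measurable_fun_fubini_tonelli_F _ _ T (measurableTypeR R) R mu g) => //.
move=> p; apply: mule_ge0; first by rewrite lee_fin normal_pdf_ge0.
exact: gauss_exp_ge0.
Qed.

Lemma measurable_gauss_exp_cons s k (f : k.+1.-tuple R -> \bar R) :
  measurable_fun setT f -> (forall z, 0 <= f z)%E ->
  measurable_fun setT (fun x => (pdf s x)%:E *
     gauss_exp s (fun z : k.-tuple R => f [tuple of x :: z]))%E.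
Proof.
move=> mf f0; apply: emeasurable_funM.
  by apply/measurable_EFinP; exact: measurable_normal_pdf.
apply: (measurable_gauss_exp _ _ s k (fun p : R * k.-tuple R => f [tuple of p.1 :: p.2])) => //.
by apply: (measurableT_comp mf); exact: measurable_cons.
Qed.

Lemma eq_gauss_exp s k (f g : k.-tuple R -> \bar R) :
  f =1 g -> gauss_exp s f = gauss_exp s g.
Proof. by move=> fg; congr gauss_exp; apply/funext. Qed.

Lemma gauss_exp_cst s k (c : \bar R) : (0 <= c)%E ->
  gauss_exp s (fun _ : k.-tuple R => c) = c.
Proof.
move=> c0; elim: k => [//|k IH] /=.
under eq_integral do rewrite IH.
rewrite ge0_integralZr ?integral_normal_pdf ?mul1e//.
- apply/measurable_EFinP; exact: measurable_normal_pdf.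
- by move=> x _; rewrite lee_fin normal_pdf_ge0.
Qed.

Lemma gauss_exp1 s k : gauss_exp s (fun _ : k.-tuple R => 1%E) = 1%E.
Proof. exact: gauss_exp_cst. Qed.

Lemma gauss_expD s k (f g : k.-tuple R -> \bar R) :
  measurable_fun setT f -> (forall z, 0 <= f z)%E ->
  measurable_fun setT g -> (forall z, 0 <= g z)%E ->
  gauss_exp s (fun z => f z + g z)%E = (gauss_exp s f + gauss_exp s g)%E.
Proof.
elim: k f g => [//|k IH] f g mf f0 mg g0 /=.
rewrite -ge0_integralD//; first last.
- exact: measurable_gauss_exp_cons.
- move=> x _; apply: mule_ge0; last exact: gauss_exp_ge0.
  by rewrite lee_fin normal_pdf_ge0.
- exact: measurable_gauss_exp_cons.
- move=> x _; apply: mule_ge0; last exact: gauss_exp_ge0.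
  by rewrite lee_fin normal_pdf_ge0.
apply: eq_integral => x _.
rewrite IH ?ge0_muleDr//; by [exact: gauss_exp_ge0|exact: measurable_cons1].
Qed.

Lemma gauss_expZ s k (c : R) (f : k.-tuple R -> \bar R) : 0 <= c ->
  measurable_fun setT f -> (forall z, 0 <= f z)%E ->
  gauss_exp s (fun z => c%:E * f z)%E = (c%:E * gauss_exp s f)%E.
Proof.
move=> c0; elim: k f => [//|k IH] f mf f0 /=.
rewrite -ge0_integralZl//; first last.
- move=> x _; apply: mule_ge0; last exact: gauss_exp_ge0.
  by rewrite lee_fin normal_pdf_ge0.
- exact: measurable_gauss_exp_cons.
apply: eq_integral => x _.
by rewrite IH//; [rewrite muleCA|exact: measurable_cons1].
Qed.

Lemma gauss_exp_sum (I : Type) (r : seq I) s k (f : I -> k.-tuple R -> \bar R) :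
  (forall i, measurable_fun setT (f i)) -> (forall i z, 0 <= f i z)%E ->
  gauss_exp s (fun z => \sum_(i <- r) f i z)%E =
  (\sum_(i <- r) gauss_exp s (f i))%E.
Proof.
move=> mf f0; elim: r => [|i r IH].
  rewrite big_nil -[RHS](gauss_exp_cst s k 0)//.
  by apply: eq_gauss_exp => z; rewrite big_nil.
rewrite big_cons -IH -gauss_expD//.
- by apply: eq_gauss_exp => z; rewrite big_cons.
- exact: emeasurable_sum.
- by move=> z; apply: sume_ge0.
Qed.

Lemma le_gauss_exp s k (f g : k.-tuple R -> \bar R) :
  measurable_fun setT f -> (forall z, 0 <= f z)%E ->
  measurable_fun setT g -> (forall z, f z <= g z)%E ->
  (gauss_exp s f <= gauss_exp s g)%E.
Proof.
elim: k f g => [|k IH] f g mf f0 mg fg /=; first exact: fg.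
have g0 z : (0 <= g z)%E by exact: le_trans (fg z).
apply: ge0_le_integral => //.
- move=> x _; apply: mule_ge0; last exact: gauss_exp_ge0.
  by rewrite lee_fin normal_pdf_ge0.
- exact: measurable_gauss_exp_cons.
- exact: measurable_gauss_exp_cons.
- move=> x _; apply: lee_wpmul2l; first by rewrite lee_fin normal_pdf_ge0.
  by apply: IH => //; exact: measurable_cons1.
Qed.

(** Tonelli's theorem on the plane, applied once for each coordinate of the tuple. It is the
    one-coordinate case from which [gauss_expC] is built. *)
Lemma gauss_exp_integralC s k (f : R * k.-tuple R -> \bar R) :
  measurable_fun setT f -> (forall p, 0 <= f p)%E ->
  (\int[mu]_x gauss_exp s (fun z => f (x, z)) =
   gauss_exp s (fun z => \int[mu]_x f (x, z)))%E.
Proof.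
elim: k f => [//|k IH] f mf f0 /=.
pose g (p : R * R) := ((pdf s p.2)%:E *
  gauss_exp s (fun z => f (p.1, [tuple of p.2 :: z])))%E.
have mfc := measurable_cons_pair _ _ _ _ mf.
have mh : measurable_fun setT (fun p : R * R =>
    gauss_exp s (fun z => f (p.1, [tuple of p.2 :: z]))).
  exact: (measurable_gauss_exp _ _ s k (fun q : (R * R) * k.-tuple R => f (q.1.1, [tuple of q.1.2 :: q.2]))).
have mg : measurable_fun setT g by apply: measurable_normal_pdfM.
rewrite (@fubini_tonelli _ _ (measurableTypeR R) (measurableTypeR R) R mu mu g)//; last first.
  move=> p; apply: mule_ge0; first by rewrite lee_fin normal_pdf_ge0.
  exact: gauss_exp_ge0.
apply: eq_integral => y _; rewrite /g/= ge0_integralZl//.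
- congr (_ * _)%E; apply: (IH (fun p => f (p.1, [tuple of y :: p.2]))) => //.
  apply: (measurableT_comp mf); apply: measurable_fun_pair => //.
  apply: measurable_cons => //; exact: measurable_cst.
- exact: (measurable_fun_section1 _ _ _ R R _ _ y mh).
- by move=> x _; exact: gauss_exp_ge0.
- by rewrite lee_fin normal_pdf_ge0.
Qed.

Lemma gauss_expC s k l (f : k.-tuple R * l.-tuple R -> \bar R) :
  measurable_fun setT f -> (forall p, 0 <= f p)%E ->
  gauss_exp s (fun z => gauss_exp s (fun w => f (z, w))) =
  gauss_exp s (fun w => gauss_exp s (fun z => f (z, w))).
Proof.
elim: k f => [//|k IH] f mf f0 /=.
have mc (x : R) : measurable_fun setT
    (fun p : k.-tuple R * l.-tuple R => f ([tuple of x :: p.1], p.2)).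
  apply: (measurableT_comp mf); apply: measurable_fun_pair => //.
  by apply: measurable_cons => //; exact: measurable_cst.
pose h (p : R * l.-tuple R) :=
  gauss_exp s (fun z : k.-tuple R => f ([tuple of p.1 :: z], p.2)).
have mh : measurable_fun setT h.
  apply: (measurable_gauss_exp _ _ s k (fun q : (R * l.-tuple R) * k.-tuple R =>
    f ([tuple of q.1.1 :: q.2], q.1.2))) => //.
  apply: (measurableT_comp mf); apply: measurable_fun_pair => //.
    by apply: measurable_cons => //; exact: measurableT_comp.
  exact: measurableT_comp.
have h0 p : (0 <= h p)%E by exact: gauss_exp_ge0.
pose g (p : R * l.-tuple R) := ((pdf s p.1)%:E * h p)%E.
have mg : measurable_fun setT g.
  apply: emeasurable_funM => //; apply/measurable_EFinP.
  exact: (measurableT_comp (measurable_normal_pdf 0 s)).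
rewrite -(gauss_exp_integralC s l g)//; last first.
  by move=> p; apply: mule_ge0 => //; rewrite lee_fin normal_pdf_ge0.
apply: eq_integral => x _.
rewrite (IH (fun p => f ([tuple of x :: p.1], p.2)))// /g/= (gauss_expZ s l (pdf s x) (fun z => h (x, z)))//.
- exact: normal_pdf_ge0.
- exact: (measurable_fun_section2 _ _ _ R _ _ _ x mh).
Qed.

End GaussianExpectation.

(** * Centred Gaussian densities on the line *)

Section Translation.
Variable R : realType.
Local Notation mu := (@lebesgue_measure R).

(** The image of Lebesgue measure under a translation gives intervals their length, so it is
    Lebesgue measure by uniqueness. *)
Lemma ge0_integral_translation (c : R) (f : R -> \bar R) :
  measurable_fun setT f -> (forall x, 0 <= f x)%E ->
  (\int[mu]_x f (c + x)%R = \int[mu]_x f x)%E.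
Proof.
move=> mf f0.
have mphi : @measurable_fun _ _ (measurableTypeR R) (measurableTypeR R) setT (+%R c).
  by apply: (@measurable_funD _ R R setT (cst c) idfun) => //; exact: measurable_id.
pose phi : {mfun measurableTypeR R >-> measurableTypeR R} :=
  HB.pack (+%R c) (isMeasurableFun.Build _ _ _ _ _ mphi).
transitivity (\int[pushforward mu phi]_y f y)%E.
  by rewrite ge0_integral_pushforward.
apply: eq_measure_integral => A mA _.
apply/esym/lebesgue_measure_unique => //= _ [[a b]] _ <-.
rewrite /pushforward/= (_ : _ @^-1` _ = `]a - c, b - c]%classic).
  rewrite !lebesgue_measure_itv/= !lte_fin ltrD2r.
  by case: ifP => // _; rewrite -!EFinB opprB addrA subrK.
by apply/seteqP; split => x /=; rewrite !in_itv/=; lra.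
Qed.

Lemma ge0_integral_reflection (f : R -> \bar R) :
  measurable_fun setT f -> (forall x, 0 <= f x)%E ->
  (\int[mu]_x f (- x)%R = \int[mu]_x f x)%E.
Proof.
move=> mf f0.
transitivity (\int[pushforward mu (-%R : _ -> measurableTypeR R)]_y f y)%E.
  by rewrite ge0_integral_pushforward.
by apply: eq_measure_integral => A mA _; exact: lebesgue_measureN.
Qed.

End Translation.

Section GaussianDensity.
Variable R : realType.
Local Notation mu := (@lebesgue_measure R).
Local Notation pdf := (@normal_pdf R 0).
Implicit Types (s t x y z : R).

Lemma normal_peak_ratio s t : 0 < s -> 0 < t ->
  normal_peak t / normal_peak s = s / t.
Proof.
move=> s0 t0; rewrite /normal_peak invrK -!mulrnAr !(sqrtrM _ (sqr_ge0 _)).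
rewrite !sqrtr_sqr !gtr0_norm//.
have p0 : Num.sqrt (pi *+ 2) != 0 :> R.
  by rewrite gt_eqF// sqrtr_gt0 mulrn_wgt0// pi_gt0.
by field; rewrite p0 gt_eqF.
Qed.

Lemma normal_pdf_ratio s t y z : 0 < s -> 0 < t ->
  pdf t y / pdf s z = s / t * expR (z ^+ 2 / (2 * s ^+ 2) - y ^+ 2 / (2 * t ^+ 2)).
Proof.
move=> s0 t0; rewrite !normal_pdfE ?gt_eqF// /normal_fun !subr0.
rewrite invfM mulrACA normal_peak_ratio// -expRN -expRD; congr (_ * expR _).
by field; rewrite !gt_eqF.
Qed.

Lemma measurable_normal_pdf_sqr s :
  measurable_fun setT (fun z => (pdf s z * z ^+ 2)%:E).
Proof.
apply/measurable_EFinP; apply: measurable_funM; first exact: measurable_normal_pdf.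
exact: measurable_funX.
Qed.

(** Kept in the extended reals, because finiteness of the second moment is itself a consequence of
    [V_upper]. *)
Let V s := (\int[mu]_z (pdf s z * z ^+ 2)%:E)%E.

Let V_ge0 s : (0 <= V s)%E.
Proof.
by apply: integral_ge0 => x _; rewrite lee_fin mulr_ge0 ?normal_pdf_ge0 ?sqr_ge0.
Qed.

Let integral_pdf_affine s (a b : R) : 0 <= a -> 0 <= b ->
  (\int[mu]_z (pdf s z * (a + b * z ^+ 2))%:E = a%:E + b%:E * V s)%E.
Proof.
move=> a0 b0.
have mp : measurable_fun setT (fun z => (pdf s z)%:E).
  by apply/measurable_EFinP; exact: measurable_normal_pdf.
have mp2 := measurable_normal_pdf_sqr s.
have p0 z : (0 <= (pdf s z)%:E)%E by rewrite lee_fin normal_pdf_ge0.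
have p20 z : (0 <= (pdf s z * z ^+ 2)%:E)%E.
  by rewrite lee_fin mulr_ge0 ?normal_pdf_ge0 ?sqr_ge0.
transitivity (\int[mu]_z (a%:E * (pdf s z)%:E + b%:E * (pdf s z * z ^+ 2)%:E))%E.
  by apply: eq_integral => z _; rewrite -!EFinM -EFinD; congr EFin; ring.
rewrite ge0_integralD//.
- by rewrite !ge0_integralZl_EFin// integral_normal_pdf mule1.
- by move=> x _; apply: mule_ge0.
- exact: measurable_funeM.
- by move=> x _; apply: mule_ge0.
- exact: measurable_funeM.
Qed.

(* Gibbs' inequality [1 + u <= expR u] for the ratio of two centred densities. *)
Let pdf_ratio_ge s t z : 0 < s -> 0 < t ->
  pdf s z * (s / t + s / t * ((s ^- 2 - t ^- 2) / 2) * z ^+ 2) <= pdf t z.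
Proof.
move=> s0 t0; rewrite mulrC -ler_pdivlMr ?normal_pdf_gt0// normal_pdf_ratio//.
have -> : s / t + s / t * ((s ^- 2 - t ^- 2) / 2) * z ^+ 2 =
    s / t * (1 + (z ^+ 2 / (2 * s ^+ 2) - z ^+ 2 / (2 * t ^+ 2))).
  by field; rewrite !gt_eqF.
by rewrite ler_pM2l ?divr_gt0// expR_ge1Dx.
Qed.

(** [pdf_ratio_ge] integrated over the line, the density on its right having mass 1. For [s < t] the
    coefficient of [z ^+ 2] is nonnegative, so only nonnegative integrands occur. *)
Let V_upper s t : 0 < s -> s < t ->
  ((s / t)%:E + (s / t * ((s ^- 2 - t ^- 2) / 2))%:E * V s <= 1)%E.
Proof.
move=> s0 st; have t0 := lt_trans s0 st.
have b0 : 0 <= (s ^- 2 - t ^- 2) / 2.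
  by rewrite divr_ge0// subr_ge0 lef_pV2 ?posrE ?exprn_gt0// lerXn2r ?nnegrE ?ltW.
have c0 : 0 <= s / t by rewrite divr_ge0// ltW.
rewrite -integral_pdf_affine ?(mulr_ge0 c0 b0)//.
rewrite -(integral_normal_pdf 0 t); apply: ge0_le_integral => //.
- move=> x _; rewrite lee_fin mulr_ge0 ?normal_pdf_ge0// addr_ge0//.
  by rewrite mulr_ge0 ?sqr_ge0// mulr_ge0.
- apply/measurable_EFinP; apply: measurable_funM; first exact: measurable_normal_pdf.
  by apply: measurable_funD => //; apply: measurable_funM => //; exact: measurable_funX.
- apply/measurable_EFinP; exact: measurable_normal_pdf.
- by move=> x _; rewrite lee_fin pdf_ratio_ge.
Qed.

(** Again [pdf_ratio_ge] integrated. For [t < s] the quadratic term is negative and is moved to the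
    other side to keep the integrands nonnegative. *)
Let V_lower s t : 0 < t -> t < s ->
  ((s / t)%:E <= 1 + (s / t * ((t ^- 2 - s ^- 2) / 2))%:E * V s)%E.
Proof.
move=> t0 ts; have s0 := lt_trans t0 ts.
have b0 : 0 <= s / t * ((t ^- 2 - s ^- 2) / 2).
  rewrite mulr_ge0 ?divr_ge0 ?ltW//.
  by rewrite subr_gt0 ltf_pV2 ?posrE ?exprn_gt0// ltrXn2r ?nnegrE// ltW.
rewrite -{1}(integral_normal_pdf 0 t).
rewrite -[X in (_ <= _ + X)%E]add0e -integral_pdf_affine//.
rewrite -ge0_integralD//=.
(* The constant [s / t] is written as the integral of an affine function of [z ^+ 2] with slope 0,
   so that both sides are integrals. *)
- rewrite -[leLHS]adde0 -(mul0e (V s)) -integral_pdf_affine ?divr_ge0 ?(ltW s0) ?(ltW t0)//.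
  apply: ge0_le_integral => //.
  + move=> x _; rewrite lee_fin mulr_ge0 ?normal_pdf_ge0// mul0r addr0.
    by rewrite divr_ge0// ltW.
  + apply/measurable_EFinP; apply: measurable_funM; first exact: measurable_normal_pdf.
    by apply: measurable_funD => //; apply: measurable_funM => //; exact: measurable_funX.
  + apply: emeasurable_funD; first by apply/measurable_EFinP; exact: measurable_normal_pdf.
    apply/measurable_EFinP; apply: measurable_funM; first exact: measurable_normal_pdf.
    by apply: measurable_funD => //; apply: measurable_funM => //; exact: measurable_funX.
  + move=> x _; rewrite lee_fin; have := pdf_ratio_ge s t x s0 t0.
    by rewrite -opprB; move: (t ^- 2 - s ^- 2) => u; nra.
- by move=> x _; rewrite lee_fin normal_pdf_ge0.
- by apply/measurable_EFinP; exact: measurable_normal_pdf.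
- by move=> x _; rewrite lee_fin mulr_ge0 ?normal_pdf_ge0// add0r mulr_ge0 ?sqr_ge0.
- apply/measurable_EFinP; apply: measurable_funM; first exact: measurable_normal_pdf.
  by apply: measurable_funD => //; apply: measurable_funM => //; exact: measurable_funX.
Qed.

(** No integration by parts: [V_upper] and [V_lower] are the two sides of Gibbs' inequality at a
    comparison deviation [t], and letting [t] lie between [s] and the root of the second moment
    refutes any value other than [s ^+ 2]. *)
Lemma integral_normal_pdf_sqr s : 0 < s ->
  (\int[mu]_z (pdf s z * z ^+ 2)%:E = (s ^+ 2)%:E)%E.
Proof.
move=> s0; rewrite -/(V s).
have [v Vv] : exists v, V s = v%:E.
  (* Any deviation larger than [s] would do: an infinite [V s] would make the left side of [V_upper]
     infinite. *)
  have st : s < s + 1 by rewrite ltrDl.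
  have t0 := lt_trans s0 st.
  have := V_upper s (s + 1) s0 st; have := V_ge0 s; case: (V s) => [v _ _|_|//].
    by exists v.
  rewrite gt0_muley// ?addey// lte_fin mulr_gt0// ?divr_gt0//.
  by rewrite subr_gt0 ltf_pV2 ?posrE ?exprn_gt0// ltrXn2r ?nnegrE// ltW.
have v0 : 0 <= v by rewrite -lee_fin -Vv.
(* [t ^+ 2] is the midpoint of [s ^+ 2] and [v], hence strictly between them whenever they
   differ. *)
pose t := Num.sqrt ((s ^+ 2 + v) / 2).
have t0 : 0 < t by rewrite sqrtr_gt0 divr_gt0// ltr_pwDl// exprn_gt0.
have t2 : t ^+ 2 = (s ^+ 2 + v) / 2.
  by rewrite sqr_sqrtr// divr_ge0// addr_ge0// sqr_ge0.
rewrite Vv; congr EFin; apply/eqP; rewrite eq_le; apply/andP; split.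
- rewrite leNgt; apply/negP => sv.
  have st : s < t by rewrite -(@ltr_pXn2r _ 2) ?nnegrE ?ltW// t2; lra.
  have := V_upper s t s0 st; rewrite Vv -EFinM -EFinD lee_fin => H.
  (* Dividing out the factor [t - s] leaves a bound incompatible with [s < t] and [t ^+ 2 < v]. *)
  have {}H : v * (t + s) <= 2 * s * t ^+ 2.
    rewrite -(@ler_pM2r _ ((t - s) / (2 * s * t ^+ 3))); last first.
      by rewrite divr_gt0 ?subr_gt0// !mulr_gt0// exprn_gt0.
    rewrite -(lerD2l (s / t)); apply: (le_trans _ (le_trans H _)); rewrite le_eqVlt;
      apply/orP; left; apply/eqP; field; by rewrite !gt_eqF.
  have : t ^+ 2 < v by rewrite t2; lra.
  nra.
- rewrite leNgt; apply/negP => sv.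
  have st : t < s by rewrite -(@ltr_pXn2r _ 2) ?nnegrE ?ltW// t2; lra.
  have := V_lower s t t0 st; rewrite Vv -EFinM -EFinD lee_fin => H.
  have {}H : 2 * s * t ^+ 2 <= v * (t + s).
    rewrite -(@ler_pM2r _ ((s - t) / (2 * s * t ^+ 3))); last first.
      by rewrite divr_gt0 ?subr_gt0// !mulr_gt0// exprn_gt0.
    rewrite -(lerD2l 1); apply: (le_trans _ (le_trans H _)); rewrite le_eqVlt;
      apply/orP; left; apply/eqP; field; by rewrite !gt_eqF.
  have : v < t ^+ 2 by rewrite t2; lra.
  nra.
Qed.

(** The cross term [2 * a * z] changes sign, so it is never integrated: by reflection [a] and [- a]
    give the same integral, and in their sum the cross terms cancel pointwise. *)
Lemma integral_normal_pdf_shift_sqr s (a c : R) : 0 < s -> 0 <= c ->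
  (\int[mu]_z ((pdf s z)%:E * ((a + z) ^+ 2 + c)%:E) = (a ^+ 2 + s ^+ 2 + c)%:E)%E.
Proof.
move=> s0 c0.
pose f b z := ((pdf s z)%:E * ((b + z) ^+ 2 + c)%:E)%E.
have f0 b z : (0 <= f b z)%E.
  by rewrite /f -EFinM lee_fin mulr_ge0 ?normal_pdf_ge0// addr_ge0// sqr_ge0.
have mf b : measurable_fun setT (f b).
  apply/measurable_EFinP; apply: measurable_funM; first exact: measurable_normal_pdf.
  by apply: measurable_funD => //; apply: measurable_funX; exact: measurable_funD.
have fN : (\int[mu]_z f (- a)%R z = \int[mu]_z f a z)%E.
  rewrite -(ge0_integral_reflection R (f a))//; apply: eq_integral => z _.
  rewrite /f !normal_pdfE ?gt_eqF// /normal_fun !subr0 sqrrN; congr (_ * _%:E)%E.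
  by ring.
have : (\int[mu]_z f a z + \int[mu]_z f (- a)%R z = (2 * (a ^+ 2 + s ^+ 2 + c))%:E)%E.
  rewrite -ge0_integralD//; [|exact: mf|exact: mf].
  transitivity (\int[mu]_z (pdf s z * (2 * (a ^+ 2 + c) + 2 * z ^+ 2))%:E)%E.
    by apply: eq_integral => z _; rewrite /f -!EFinM -EFinD; congr EFin; ring.
  rewrite integral_pdf_affine ?mulr_ge0 ?addr_ge0 ?sqr_ge0//.
  by rewrite /V integral_normal_pdf_sqr// -EFinM -EFinD; congr EFin; ring.
have : (0 <= \int[mu]_z f a z)%E by apply: integral_ge0.
rewrite fN -/(f a); case: (integral mu setT (f a)) => [r _|//|//].
by rewrite -EFinD => -[] H; congr EFin; lra.
Qed.

End GaussianDensity.

(** * Change of measure *)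

Section ChangeOfMeasure.
Variable R : realType.
Local Notation mu := (@lebesgue_measure R).
Local Notation pdf := (@normal_pdf R 0).
Implicit Types (s t : R) (k : nat).

Definition addt k (x z : k.-tuple R) : k.-tuple R :=
  [tuple tnth x i + tnth z i | i < k].

(* Likelihood ratio, at the noise value [z], of N(0, t^2 I) to N(x, s^2 I),
   both evaluated at the output [x + z]. *)
Definition likelihood_ratio t s k (x z : k.-tuple R) : R :=
  \prod_(i < k) (pdf t (tnth x i + tnth z i) / pdf s (tnth z i)).

Lemma addt_cons k (a b : R) (x z : k.-tuple R) :
  addt k.+1 [tuple of a :: x] [tuple of b :: z] = [tuple of a + b :: addt k x z].
Proof.
apply: eq_from_tnth => i; rewrite tnth_mktuple.
case: (unliftP ord0 i) => [j|] ->; last by rewrite !tnth0.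
by rewrite !tnthS tnth_mktuple.
Qed.

Lemma likelihood_ratio_cons t s k (a b : R) (x z : k.-tuple R) :
  likelihood_ratio t s k.+1 [tuple of a :: x] [tuple of b :: z] =
  pdf t (a + b) / pdf s b * likelihood_ratio t s k x z.
Proof.
rewrite /likelihood_ratio big_ord_recl !tnth0; congr (_ * _).
by apply: eq_bigr => i _; rewrite !tnthS.
Qed.

Lemma likelihood_ratio_ge0 t s k (x z : k.-tuple R) :
  0 <= likelihood_ratio t s k x z.
Proof. by apply: prodr_ge0 => i _; rewrite divr_ge0// normal_pdf_ge0. Qed.

Lemma measurable_addt d (T : measurableType d) k (f g : T -> k.-tuple R) :
  measurable_fun setT f -> measurable_fun setT g ->
  measurable_fun setT (fun z => addt k (f z) (g z)).
Proof.
move=> mf mg; apply/measurable_fun_tnthP => i.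
rewrite (_ : _ \o _ = fun z => tnth (f z) i + tnth (g z) i); last first.
  by apply/funext => z /=; rewrite tnth_mktuple.
apply: measurable_funD.
  apply: (@measurableT_comp _ _ _ _ _ _ (fun w : k.-tuple R => tnth w i)) => //.
  exact: measurable_tnth.
apply: (@measurableT_comp _ _ _ _ _ _ (fun w : k.-tuple R => tnth w i)) => //.
exact: measurable_tnth.
Qed.

Lemma likelihood_ratioE t s k (x z : k.-tuple R) : 0 < s -> 0 < t ->
  likelihood_ratio t s k x z = (s / t) ^+ k *
   expR ((\sum_(i < k) tnth z i ^+ 2) / (2 * s ^+ 2) -
         (\sum_(i < k) (tnth x i + tnth z i) ^+ 2) / (2 * t ^+ 2)).
Proof.
move=> s0 t0; rewrite /likelihood_ratio.
under eq_bigr do rewrite normal_pdf_ratio//.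
rewrite big_split/= prodr_const card_ord -expR_sum; congr (_ * expR _).
by rewrite sumrB !mulr_suml.
Qed.

Lemma measurable_sum_sqr k (x : k.-tuple R) :
  measurable_fun setT (fun z => \sum_(i < k) (tnth x i + tnth z i) ^+ 2).
Proof.
apply: measurable_sum => i; apply: measurable_funX; apply: measurable_funD => //.
exact: measurable_tnth.
Qed.

Lemma measurable_likelihood_ratio t s k (x : k.-tuple R) : 0 < s -> 0 < t ->
  measurable_fun setT (likelihood_ratio t s k x).
Proof.
move=> s0 t0; rewrite (funext (fun z => likelihood_ratioE t s k x z s0 t0)).
apply: measurable_funM => //; apply: measurableT_comp => //.
apply: measurable_funB; apply: measurable_funM => //; last exact: measurable_sum_sqr.
rewrite (_ : (fun _ => _) =
  fun z => \sum_(i < k) (tnth [tuple 0 : R | i < k] i + tnth z i) ^+ 2).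
  exact: measurable_sum_sqr.
by apply/funext => z; apply: eq_bigr => i _; rewrite tnth_mktuple add0r.
Qed.

(** In each coordinate the density [pdf s b] cancels the denominator of the ratio, and what is left
    is an integral translated by the codeword entry. *)
Lemma gauss_exp_change t s k (x : k.-tuple R) (f : k.-tuple R -> \bar R) :
  0 < s -> 0 < t -> measurable_fun setT f -> (forall z, 0 <= f z)%E ->
  gauss_exp s (fun z => (likelihood_ratio t s k x z)%:E * f (addt k x z))%E =
  gauss_exp t f.
Proof.
move=> s0 t0; elim: k x f => [|k IH] x f mf f0.
  rewrite /= /likelihood_ratio big_ord0 mul1e; congr f; by rewrite [LHS]tuple0 [RHS]tuple0.
case/tupleP: x => a x /=.
pose g b := ((pdf t b)%:E * gauss_exp t (fun z : k.-tuple R => f [tuple of b :: z]))%E.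
(* Translation makes the noise, rather than the output, the integration variable on the right. *)
rewrite -/(\int[mu]_b g b)%E -(ge0_integral_translation R a g); first last.
- by move=> b; rewrite mule_ge0 ?lee_fin ?normal_pdf_ge0 ?gauss_exp_ge0.
- exact: measurable_gauss_exp_cons.
apply: eq_integral => b _.
rewrite /g -(IH x (fun z => f [tuple of a + b :: z]))//; last first.
  exact: measurable_cons1.
have p0 := normal_pdf_gt0 R s b s0.
transitivity ((pdf s b)%:E * ((pdf t (a + b) / pdf s b)%:E *
    gauss_exp s (fun z : k.-tuple R =>
      (likelihood_ratio t s k x z)%:E * f [tuple of (a + b)%R :: addt k x z])))%E.
  congr (_ * _)%E; rewrite -gauss_expZ.
  - apply: eq_gauss_exp => z.
    by rewrite likelihood_ratio_cons addt_cons EFinM muleA.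
  - by rewrite divr_ge0// normal_pdf_ge0.
  - apply: emeasurable_funM.
      by apply/measurable_EFinP; exact: measurable_likelihood_ratio.
    apply: (measurableT_comp mf); apply: measurable_cons => //.
    by apply: measurable_addt => //; exact: measurable_cst.
  - by move=> z; rewrite mule_ge0 ?lee_fin ?likelihood_ratio_ge0.
by rewrite muleA -EFinM mulrC divfK// gt_eqF.
Qed.

(** The cross terms vanish coordinate by coordinate; the expected energy of the remaining
    coordinates enters [integral_normal_pdf_shift_sqr] as its constant [c]. *)
Lemma gauss_exp_sum_sqr s k (x : k.-tuple R) : 0 < s ->
  gauss_exp s (fun z => (\sum_(i < k) (tnth x i + tnth z i) ^+ 2)%:E) =
  (\sum_(i < k) tnth x i ^+ 2 + k%:R * s ^+ 2)%:E.
Proof.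
move=> s0; elim: k x => [|k IH] x; first by rewrite /= !big_ord0 mul0r addr0.
case/tupleP: x => a x.
have S0 : 0 <= \sum_(i < k) tnth x i ^+ 2 + k%:R * s ^+ 2.
  apply: addr_ge0; first by apply: sumr_ge0 => i _; exact: sqr_ge0.
  by apply: mulr_ge0 => //; exact: sqr_ge0.
rewrite big_ord_recl tnth0 /=.
under [X in _ = (_ + X + _)%:E]eq_bigr do rewrite tnthS.
transitivity (\int[mu]_z ((pdf s z)%:E * ((a + z) ^+ 2 +
    (\sum_(i < k) tnth x i ^+ 2 + k%:R * s ^+ 2))%:E))%E; last first.
  rewrite integral_normal_pdf_shift_sqr//; congr EFin.
  by rewrite -(natr1 k); ring.
apply: eq_integral => b _; congr (_ * _)%E.
transitivity (gauss_exp s (fun z : k.-tuple R =>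
    ((a + b) ^+ 2)%:E + (\sum_(i < k) (tnth x i + tnth z i) ^+ 2)%:E)%E).
  apply: eq_gauss_exp => z; rewrite -EFinD; congr EFin.
  by rewrite big_ord_recl !tnth0; congr (_ + _); apply: eq_bigr => i _; rewrite !tnthS.
rewrite gauss_expD// ?gauss_exp_cst ?lee_fin ?sqr_ge0 ?IH ?EFinD//.
- by apply/measurable_EFinP; exact: measurable_sum_sqr.
- by move=> z; rewrite lee_fin sumr_ge0// => i _; exact: sqr_ge0.
Qed.

End ChangeOfMeasure.

(** * Fano's inequality *)

Section Fano.
Variable R : realType.
Implicit Types (s t : R) (k n M : nat).

Lemma measurable_EFin_bool d (T : measurableType d) (b : T -> bool) :
  measurable_fun setT b -> measurable_fun setT (fun x => ((b x)%:R : R)%:E).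
Proof.
move=> mb; rewrite (_ : (fun _ => _) = fun x => if b x then 1%E else 0%E).
  exact: measurable_fun_ifT.
by apply/funext => x; case: (b x).
Qed.

(* [1 + u <= expR u] applied to the likelihood ratio weighted by [M] on a
   decoding region and by [1] off it. *)
Lemma likelihood_ratio_ge s t n M (x z : n.-tuple R) (b : bool) :
  0 < s -> 0 < t -> (0 < M)%N ->
  (1 + ln M%:R) + (\sum_(i < n) tnth z i ^+ 2) / (2 * s ^+ 2) <=
  ln M%:R * (~~ b)%:R + (n%:R * ln (t / s) +
    (\sum_(i < n) (tnth x i + tnth z i) ^+ 2) / (2 * t ^+ 2)) +
  likelihood_ratio R t s n x z * (M%:R * b%:R + 1).
Proof.
move=> s0 t0 M0; rewrite likelihood_ratioE//.
set A := _ / (2 * s ^+ 2); set B := _ / (2 * t ^+ 2).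
have st0 : 0 < s / t by rewrite divr_gt0.
have M1 : 0 < M%:R :> R by rewrite ltr0n.
have -> : (s / t) ^+ n = expR (- (n%:R * ln (t / s))).
  by rewrite -mulrN -lnV ?posrE ?divr_gt0// invf_div expRM_natl lnK.
set u := n%:R * ln (t / s); rewrite -expRD.
have e0 := expR_gt0 (- u + (A - B)).
(* On the decoding region the factor [M] enters the exponent as [ln M%:R] and the summand 1 of the
   weight is slack; off it the weight is 1 and the error term supplies [ln M%:R]. *)
case: b => /=.
  have := expR_ge1Dx (ln M%:R + (- u + (A - B))).
  by rewrite expRD lnK ?posrE//; nra.
have := expR_ge1Dx (- u + (A - B)); nra.
Qed.

Lemma gauss_exp_sum_sqr_div s n (x : n.-tuple R) (c : R) : 0 < s -> 0 <= c ->
  gauss_exp s (fun z => ((\sum_(i < n) (tnth x i + tnth z i) ^+ 2) / c)%:E) =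
  ((\sum_(i < n) tnth x i ^+ 2 + n%:R * s ^+ 2) / c)%:E.
Proof.
move=> s0 c0; rewrite mulrC EFinM -(gauss_exp_sum_sqr R)// -gauss_expZ ?invr_ge0//.
- by apply: eq_gauss_exp => z; rewrite -EFinM mulrC.
- by apply/measurable_EFinP; exact: measurable_sum_sqr.
- by move=> z; rewrite lee_fin sumr_ge0// => i _; exact: sqr_ge0.
Qed.

(** The decoding regions partition the output space, so their masses under one common output law add
    up to 1. *)
Lemma sum_gauss_exp_decoder s n M (dec : n.-tuple R -> 'I_M) :
  (forall m, measurable_fun setT (fun y => dec y == m)) ->
  (\sum_(m < M) gauss_exp s (fun y => ((dec y == m)%:R : R)%:E) = 1)%E.
Proof.
move=> mdec; rewrite -gauss_exp_sum; first last.
- by move=> m z; rewrite lee_fin.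
- by move=> m; exact: measurable_EFin_bool.
rewrite -[RHS](gauss_exp1 R s n); apply: eq_gauss_exp => y.
rewrite sumEFin; congr EFin.
by rewrite (bigD1 (dec y))//= eqxx big1 ?addr0// => m /negPf; rewrite eq_sym => ->.
Qed.

(** Expectation of [likelihood_ratio_ge] for each message, then the sum over messages. The expected
    noise energy yields [n%:R / 2]. Every term sits on the side where it is nonnegative, so
    additivity needs no integrability. *)
Lemma gaussian_fano s t n M (x : 'I_M -> n.-tuple R) (dec : n.-tuple R -> 'I_M) :
  0 < s -> s <= t -> (forall m, measurable_fun setT (fun y => dec y == m)) ->
  ((M%:R * (ln M%:R + n%:R / 2))%:E <=
   (ln M%:R)%:E * (\sum_(m < M)
      gauss_exp s (fun z => ((dec (addt R n (x m) z) != m)%:R : R)%:E)) +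
   (M%:R * (n%:R * ln (t / s)) +
    ((\sum_(m < M) \sum_(i < n) tnth (x m) i ^+ 2) + M%:R * n%:R * s ^+ 2) /
      (2 * t ^+ 2) + M%:R)%:E)%E.
Proof.
move=> s0 st mdec; have t0 := lt_le_trans s0 st.
have M0 : (0 < M)%N by case: (dec [tuple 0 | i < n]) => m; exact: leq_ltn_trans.
have L0 : 0 <= ln M%:R :> R by rewrite ln_ge0// ler1n.
have u0 : 0 <= n%:R * ln (t / s).
  by rewrite mulr_ge0// ln_ge0// ler_pdivlMr// mul1r.
pose err m := gauss_exp s (fun z => ((dec (addt R n (x m) z) != m)%:R : R)%:E).
pose q m := gauss_exp t (fun y => ((dec y == m)%:R : R)%:E).
pose C m := n%:R * ln (t / s) +
  (\sum_(i < n) tnth (x m) i ^+ 2 + n%:R * s ^+ 2) / (2 * t ^+ 2).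
have step m : ((ln M%:R + n%:R / 2)%:E <=
    (ln M%:R)%:E * err m + (C m)%:E + M%:R%:E * q m)%E.
  (* With a zero codeword the energy of the bare noise is an instance of the lemmas on shifted
     noise. *)
  pose x0 : n.-tuple R := [tuple 0 | i < n].
  have sqr0 (z : n.-tuple R) :
      \sum_(i < n) tnth z i ^+ 2 = \sum_(i < n) (tnth x0 i + tnth z i) ^+ 2.
    by apply: eq_bigr => i _; rewrite tnth_mktuple add0r.
  have mS (y : n.-tuple R) (c : R) : measurable_fun setT
      (fun z => ((\sum_(i < n) (tnth y i + tnth z i) ^+ 2) / c)%:E).
    apply/measurable_EFinP; apply: measurable_funM => //.
    exact: measurable_sum_sqr.
  have S0 (y z : n.-tuple R) (c : R) : 0 < c ->
      (0 <= ((\sum_(i < n) (tnth y i + tnth z i) ^+ 2) / c)%:E)%E.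
    move=> c0; rewrite lee_fin divr_ge0 ?(ltW c0)// sumr_ge0// => i _.
    exact: sqr_ge0.
  have s20 : 0 < 2 * s ^+ 2 by rewrite mulr_gt0// exprn_gt0.
  have t20 : 0 < 2 * t ^+ 2 by rewrite mulr_gt0// exprn_gt0.
  have merr : measurable_fun setT
      (fun z => ((dec (addt R n (x m) z) != m)%:R : R)%:E).
    apply: measurable_EFin_bool; apply: measurable_neg.
    apply: (measurableT_comp (mdec m)).
    by apply: measurable_addt => //; exact: measurable_cst.
  have mq : measurable_fun setT (fun y => ((dec y == m)%:R : R)%:E).
    exact: measurable_EFin_bool.
  have G0 (b : bool) : (0 <= M%:R%:E * (b%:R : R)%:E + 1)%E.
    by rewrite -EFinM -EFinD lee_fin addr_ge0// mulr_ge0.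
  (* Under the change of measure the weighted ratio becomes [M] times the mass of the decoding
     region under the common output law, plus 1. *)
  have qE : gauss_exp s (fun z => (likelihood_ratio R t s n (x m) z)%:E *
      ((M%:R)%:E * ((dec (addt R n (x m) z) == m)%:R : R)%:E + 1))%E =
      (M%:R%:E * q m + 1)%E.
    rewrite (gauss_exp_change R t s n (x m)
      (fun y => M%:R%:E * ((dec y == m)%:R : R)%:E + 1)%E)//.
    + rewrite gauss_expD//; first by rewrite gauss_expZ// gauss_exp1.
      exact: measurable_funeM.
    + by apply: emeasurable_funD => //; exact: measurable_funeM.
  have mF : measurable_fun setT (fun z => (likelihood_ratio R t s n (x m) z)%:E *
      ((M%:R)%:E * ((dec (addt R n (x m) z) == m)%:R : R)%:E + 1))%E.
    apply: emeasurable_funM.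
      by apply/measurable_EFinP; exact: measurable_likelihood_ratio.
    apply: emeasurable_funD => //; apply: measurable_funeM.
    apply: (measurableT_comp mq).
    by apply: measurable_addt => //; exact: measurable_cst.
  have F0 z : (0 <= (likelihood_ratio R t s n (x m) z)%:E *
      ((M%:R)%:E * ((dec (addt R n (x m) z) == m)%:R : R)%:E + 1))%E.
    by apply: mule_ge0; [rewrite lee_fin likelihood_ratio_ge0|exact: G0].
  (* The added 1 is the constant of [1 + u <= expR u] on the left and the total mass of the
     likelihood ratio on the right. *)
  rewrite -(@leeD2rE _ 1%E)//.
  have -> : ((ln M%:R + n%:R / 2)%:E + 1 = gauss_exp s (fun z =>
      (1 + ln M%:R)%:E + ((\sum_(i < n) (tnth x0 i + tnth z i) ^+ 2) / (2 * s ^+ 2))%:E)%E)%E.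
    rewrite gauss_expD//; first last.
    - by move=> z; exact: S0.
    - by move=> z; rewrite lee_fin addr_ge0.
    rewrite gauss_exp_cst ?lee_fin ?addr_ge0// gauss_exp_sum_sqr_div ?ltW//.
    rewrite -EFinD -EFinD; congr EFin; rewrite big1 => [|i _]; last first.
      by rewrite tnth_mktuple expr0n.
    by field; rewrite gt_eqF.
  have -> : ((ln M%:R)%:E * err m + (C m)%:E + M%:R%:E * q m + 1 =
    gauss_exp s (fun z => (ln M%:R)%:E * ((dec (addt R n (x m) z) != m)%:R : R)%:E +
      ((n%:R * ln (t / s))%:E +
       ((\sum_(i < n) (tnth (x m) i + tnth z i) ^+ 2) / (2 * t ^+ 2))%:E) +
      (likelihood_ratio R t s n (x m) z)%:E *
        ((M%:R)%:E * ((dec (addt R n (x m) z) == m)%:R : R)%:E + 1))%E)%E.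
    rewrite gauss_expD//; first last.
    - move=> z; rewrite adde_ge0 ?mule_ge0 ?lee_fin//.
      by rewrite addr_ge0// -lee_fin S0.
    - apply: emeasurable_funD; first exact: measurable_funeM.
      by apply: emeasurable_funD.
    rewrite qE addeA; congr (_ + _ + _)%E.
    rewrite gauss_expD//; first last.
    - by move=> z; rewrite lee_fin addr_ge0// -lee_fin S0.
    - exact: emeasurable_funD.
    - by move=> z; rewrite mule_ge0.
    - exact: measurable_funeM.
    rewrite gauss_expZ//; congr (_ + _)%E.
    rewrite gauss_expD//; last by move=> z; exact: S0.
    by rewrite gauss_exp_cst ?lee_fin// gauss_exp_sum_sqr_div ?ltW// -EFinD.
  apply: le_gauss_exp.
  - exact: emeasurable_funD.
  - by move=> z; rewrite adde_ge0 ?S0// lee_fin addr_ge0.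
  - apply: emeasurable_funD => //; apply: emeasurable_funD; first exact: measurable_funeM.
    exact: emeasurable_funD.
  - move=> z; rewrite -sqr0 -!(EFinM, EFinD) lee_fin.
    exact: likelihood_ratio_ge.
have err0 m : (0 <= err m)%E by apply: gauss_exp_ge0 => z; rewrite lee_fin.
have q0 m : (0 <= q m)%E by apply: gauss_exp_ge0 => z; rewrite lee_fin.
have C0 m : (0 <= (C m)%:E)%E.
  rewrite lee_fin addr_ge0// divr_ge0//; last by rewrite mulr_ge0// sqr_ge0.
  apply: addr_ge0; first by apply: sumr_ge0 => i _; exact: sqr_ge0.
  by rewrite mulr_ge0// sqr_ge0.
have : (\sum_(m < M) (ln M%:R + n%:R / 2)%:E <=
    \sum_(m < M) ((ln M%:R)%:E * err m + (C m)%:E + M%:R%:E * q m))%E.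
  by apply: lee_sum => m _; exact: step.
rewrite !big_split/= -!ge0_sume_distrr// sum_gauss_exp_decoder// mule1.
rewrite !sumEFin -addeA -EFinD sumr_const card_ord -[(_ + _) *+ M]mulr_natl.
suff -> : \sum_(m < M) C m = M%:R * (n%:R * ln (t / s)) +
    ((\sum_(m < M) \sum_(i < n) tnth (x m) i ^+ 2) + M%:R * n%:R * s ^+ 2) /
      (2 * t ^+ 2) by [].
rewrite big_split/= sumr_const card_ord -mulr_suml big_split/= sumr_const card_ord.
by rewrite -[_ * ln _ *+ M]mulr_natl -[_ * s ^+ 2 *+ M]mulr_natl (mulrA _ _ (s ^+ 2)).
Qed.

End Fano.

(** * Converse bounds for codes *)

Section NoiseExpectation.
Variables (R : realType) (s : R) (n m : nat).
Implicit Types f h : n.-tuple R -> n.-tuple R -> m.-tuple R -> \bar R.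

Lemma measurable_eq_preimage d (T : measurableType d) (I : eqType) (f : T -> I) (i : I) :
  measurable (f @^-1` [set i]) -> measurable_fun setT (fun x => f x == i).
Proof.
move=> mf; apply: (measurable_fun_bool true); rewrite setTI.
rewrite (_ : _ @^-1` _ = f @^-1` [set i])//.
by apply/seteqP; split => x /= /eqP.
Qed.

Lemma measurable_noise2 f : (forall z1 z2 z3, 0 <= f z1 z2 z3)%E ->
  measurable_fun setT (fun p : (n.-tuple R * n.-tuple R) * m.-tuple R =>
    f p.1.1 p.1.2 p.2) ->
  measurable_fun setT (fun p : n.-tuple R * n.-tuple R =>
    gauss_exp s (fun z3 => f p.1 p.2 z3)).
Proof.
move=> f0 mf; exact: (measurable_gauss_exp R _ _ s m
  (fun p : (n.-tuple R * n.-tuple R) * m.-tuple R => f p.1.1 p.1.2 p.2)).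
Qed.

Lemma le_noise_exp f h :
  measurable_fun setT (fun p : (n.-tuple R * n.-tuple R) * m.-tuple R =>
    f p.1.1 p.1.2 p.2) ->
  measurable_fun setT (fun p : (n.-tuple R * n.-tuple R) * m.-tuple R =>
    h p.1.1 p.1.2 p.2) ->
  (forall z1 z2 z3, 0 <= f z1 z2 z3)%E ->
  (forall z1 z2 z3, f z1 z2 z3 <= h z1 z2 z3)%E ->
  (noise_exp s f <= noise_exp s h)%E.
Proof.
move=> mf mh f0 fh.
have h0 z1 z2 z3 : (0 <= h z1 z2 z3)%E by exact: le_trans (fh _ _ _).
have mf2 := measurable_noise2 f f0 mf; have mh2 := measurable_noise2 h h0 mh.
have mf1 := measurable_gauss_exp R _ _ s n _ mf2 (fun p => gauss_exp_ge0 R s m _ (f0 p.1 p.2)).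
have mh1 := measurable_gauss_exp R _ _ s n _ mh2 (fun p => gauss_exp_ge0 R s m _ (h0 p.1 p.2)).
apply: le_gauss_exp => //.
  by move=> z; do 2 apply: gauss_exp_ge0 => ?.
move=> z1; apply: le_gauss_exp.
- exact: (measurable_fun_section2 _ _ _ _ _ _ _ z1 mf2).
- by move=> z; apply: gauss_exp_ge0 => ?.
- exact: (measurable_fun_section2 _ _ _ _ _ _ _ z1 mh2).
move=> z2; apply: le_gauss_exp => //.
- exact: (measurable_fun_section2 _ _ _ _ _ _ _ (z1, z2) mf).
- exact: (measurable_fun_section2 _ _ _ _ _ _ _ (z1, z2) mh).
Qed.

(** Brings the receiver noise of M2 innermost, so that the downlink can be treated with [z2] and
    [z3] fixed. *)
Lemma noise_exp_rot f :
  measurable_fun setT (fun p : (n.-tuple R * n.-tuple R) * m.-tuple R =>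
    f p.1.1 p.1.2 p.2) ->
  (forall z1 z2 z3, 0 <= f z1 z2 z3)%E ->
  noise_exp s f = gauss_exp s (fun z2 => gauss_exp s (fun z3 =>
    gauss_exp s (fun z1 => f z1 z2 z3))).
Proof.
move=> mf f0; rewrite /noise_exp.
rewrite (gauss_expC R s n n (fun p => gauss_exp s (fun z3 => f p.1 p.2 z3))); first last.
- by move=> p; exact: gauss_exp_ge0.
- exact: measurable_noise2.
apply: eq_gauss_exp => z2.
rewrite (gauss_expC R s n m (fun p => f p.1 z2 p.2))//.
have mg : measurable_fun setT (fun p : n.-tuple R * m.-tuple R => ((p.1, z2), p.2)).
  by apply: measurable_fun_pair => //; exact: measurable_fun_pair.
exact: (measurableT_comp mf mg).
Qed.

(** Averages a bound of Fano type over noise that was held fixed. It is affine in the error and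
    energy terms, so linearity and monotonicity suffice. *)
Lemma gauss_exp_affine_bound k M (a b : R) (e : 'I_M -> k.-tuple R -> \bar R)
    (p : k.-tuple R -> \bar R) : 0 <= a -> 0 <= b ->
  (forall i, measurable_fun setT (e i)) -> (forall i z, 0 <= e i z)%E ->
  measurable_fun setT p -> (forall z, 0 <= p z)%E ->
  (forall z, a%:E <= b%:E * (\sum_(i < M) e i z) + p z)%E ->
  (a%:E <= b%:E * (\sum_(i < M) gauss_exp s (e i)) + gauss_exp s p)%E.
Proof.
move=> a0 b0 me e0 mp p0 H.
have ms : measurable_fun setT (fun z => \sum_(i < M) e i z)%E by exact: emeasurable_sum.
have s0 z : (0 <= \sum_(i < M) e i z)%E by exact: sume_ge0.
rewrite -gauss_exp_sum// -gauss_expZ// -gauss_expD//.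
- rewrite -(gauss_exp_cst R s k a%:E)//; apply: le_gauss_exp => //.
  by apply: emeasurable_funD => //; exact: measurable_funeM.
- exact: measurable_funeM.
- by move=> z; exact: mule_ge0.
Qed.

End NoiseExpectation.

(** * Signals and error events of a code *)

Section CodeConverse.
Variables (R : realType) (g1 g2 g21m g21s : R) (n ms : nat) (c : Defs.code R n ms).
Hypothesis mc : code_measurable c.

(** A total decoder into ['I_(M1 c)] cannot exist for an empty message set. *)
Lemma codebook1_gt0 : (0 < M1 c)%N.
Proof.
by case: (decM2 c ([tuple 0 | i < n], [tuple 0 | i < ms])) => k; exact: leq_ltn_trans.
Qed.

Lemma codebook2_gt0 : (0 < M2 c)%N.
Proof.
by case: (decBS (Ordinal codebook1_gt0) [tuple 0 | i < n]) => k; exact: leq_ltn_trans.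
Qed.

Lemma sigY2E (s2 : 'I_(M2 c)) z2 :
  sigY2 g2 s2 z2 = addt R n [tuple g2 * tnth (encX2 s2) i | i < n] z2.
Proof. by apply: eq_from_tnth => i; rewrite !tnth_mktuple. Qed.

Lemma sigY3E (s2 : 'I_(M2 c)) z3 :
  sigY3 g21s s2 z3 = addt R ms [tuple g21s * tnth (encX3 s2) i | i < ms] z3.
Proof. by apply: eq_from_tnth => i; rewrite !tnth_mktuple. Qed.

(** The interference is the outer shift, so that it can be absorbed into the decoder while [g1 * X1]
    plays the codeword. *)
Lemma sigY1E (s1 : 'I_(M1 c)) (s2 : 'I_(M2 c)) z1 z2 :
  sigY1 g1 g2 g21m s1 s2 z1 z2 =
  addt R n [tuple g21m * tnth (encX2 s2) i | i < n]
    (addt R n [tuple g1 * sigX1 g2 s1 s2 z2 i | i < n] z1).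
Proof. by apply: eq_from_tnth => i; rewrite !tnth_mktuple addrA (addrC (g1 * _)). Qed.

Lemma measurable_sigY2 d (T : measurableType d) (f : T -> n.-tuple R) (s2 : 'I_(M2 c)) :
  measurable_fun setT f -> measurable_fun setT (fun x => sigY2 g2 s2 (f x)).
Proof.
move=> mf; rewrite (_ : (fun _ => _) = fun x =>
  addt R n [tuple g2 * tnth (encX2 s2) i | i < n] (f x)).
  by apply: measurable_addt => //; exact: measurable_cst.
by apply/funext => x; rewrite sigY2E.
Qed.

Lemma measurable_sigX1 d (T : measurableType d) (f : T -> n.-tuple R)
    (s1 : 'I_(M1 c)) (s2 : 'I_(M2 c)) i :
  measurable_fun setT f -> measurable_fun setT (fun x => sigX1 g2 s1 s2 (f x) i).
Proof.
move=> mf; have [mX _] := mc.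
exact: (measurableT_comp (mX s1 i) (measurable_sigY2 _ _ _ s2 mf)).
Qed.

Lemma measurable_scaled_sigX1 d (T : measurableType d) (f : T -> n.-tuple R)
    (s1 : 'I_(M1 c)) (s2 : 'I_(M2 c)) :
  measurable_fun setT f ->
  measurable_fun setT (fun x => [tuple g1 * sigX1 g2 s1 s2 (f x) i | i < n]).
Proof.
move=> mf; apply/measurable_fun_tnthP => i.
rewrite (_ : _ \o _ = fun x => g1 * sigX1 g2 s1 s2 (f x) i).
  by apply: measurable_funM => //; exact: measurable_sigX1.
by apply/funext => x /=; rewrite tnth_mktuple.
Qed.

Lemma measurable_decBS d (T : measurableType d) (f : T -> n.-tuple R) s1 s2 :
  measurable_fun setT f ->
  measurable_fun setT (fun x => decBS (c := c) s1 (f x) == s2).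
Proof.
move=> mf; have [_ [_ mD]] := mc.
exact: (measurableT_comp (measurable_eq_preimage _ _ _ (decBS s1) s2 (mD s1 s2)) mf).
Qed.

Lemma measurable_decM2 d (T : measurableType d) (f : T -> n.-tuple R * ms.-tuple R) s1 :
  measurable_fun setT f -> measurable_fun setT (fun x => decM2 c (f x) == s1).
Proof.
move=> mf; have [_ [mD _]] := mc.
exact: (measurableT_comp (measurable_eq_preimage _ _ _ (decM2 c) s1 (mD s1)) mf).
Qed.

Definition err1 (s1 : 'I_(M1 c)) (s2 : 'I_(M2 c)) z1 z2 z3 : \bar R :=
  ((decM2 c (sigY1 g1 g2 g21m s1 s2 z1 z2, sigY3 g21s s2 z3) != s1)%:R : R)%:E.

Definition err2 (s1 : 'I_(M1 c)) (s2 : 'I_(M2 c)) z2 : \bar R :=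
  ((decBS s1 (sigY2 g2 s2 z2) != s2)%:R : R)%:E.

Lemma measurable_decode1 d (T : measurableType d) (f1 f2 : T -> n.-tuple R)
    (f3 : T -> ms.-tuple R) (s1 : 'I_(M1 c)) (s2 : 'I_(M2 c)) :
  measurable_fun setT f1 -> measurable_fun setT f2 -> measurable_fun setT f3 ->
  measurable_fun setT (fun x =>
    decM2 c (sigY1 g1 g2 g21m s1 s2 (f1 x) (f2 x), sigY3 g21s s2 (f3 x)) == s1).
Proof.
move=> mf1 mf2 mf3; apply: measurable_decM2; apply: measurable_fun_pair.
- rewrite (_ : (fun _ => _) = fun x =>
    addt R n [tuple g21m * tnth (encX2 s2) i | i < n]
    (addt R n [tuple g1 * sigX1 g2 s1 s2 (f2 x) i | i < n] (f1 x))).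
    apply: measurable_addt; first exact: measurable_cst.
    by apply: measurable_addt => //; exact: measurable_scaled_sigX1.
  by apply/funext => x; rewrite sigY1E.
- rewrite (_ : (fun _ => _) = fun x =>
    addt R ms [tuple g21s * tnth (encX3 s2) i | i < ms] (f3 x)).
    by apply: measurable_addt => //; exact: measurable_cst.
  by apply/funext => x; rewrite sigY3E.
Qed.

Lemma measurable_err1 d (T : measurableType d) (f1 f2 : T -> n.-tuple R)
    (f3 : T -> ms.-tuple R) (s1 : 'I_(M1 c)) (s2 : 'I_(M2 c)) :
  measurable_fun setT f1 -> measurable_fun setT f2 -> measurable_fun setT f3 ->
  measurable_fun setT (fun x => err1 s1 s2 (f1 x) (f2 x) (f3 x)).
Proof.
move=> mf1 mf2 mf3; apply: measurable_EFin_bool; apply: measurable_neg.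
exact: measurable_decode1.
Qed.

Lemma measurable_err2 d (T : measurableType d) (f : T -> n.-tuple R)
    (s1 : 'I_(M1 c)) (s2 : 'I_(M2 c)) :
  measurable_fun setT f -> measurable_fun setT (fun x => err2 s1 s2 (f x)).
Proof.
move=> mf; apply: measurable_EFin_bool; apply: measurable_neg.
by apply: measurable_decBS; exact: measurable_sigY2.
Qed.

Let T3 := ((n.-tuple R * n.-tuple R) * ms.-tuple R)%type.

Lemma measurable_err_ind (s1 : 'I_(M1 c)) (s2 : 'I_(M2 c)) :
  measurable_fun setT (fun p : T3 =>
    err_ind g1 g2 g21m g21s s1 s2 p.1.1 p.1.2 p.2).
Proof.
have m1 : measurable_fun setT (fun p : T3 => p.1.1) by exact: measurableT_comp.
have m2 : measurable_fun setT (fun p : T3 => p.1.2) by exact: measurableT_comp.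
apply: measurable_fun_ifT => //; apply: measurable_or; apply: measurable_neg.
  exact: measurable_decode1.
by apply: measurable_decBS; exact: measurable_sigY2.
Qed.

(** An error at BS is part of the joint error event. It depends on [z2] alone, so the other two
    expectations act on a constant. *)
Lemma noise_exp_err2_le s (s1 : 'I_(M1 c)) (s2 : 'I_(M2 c)) :
  (gauss_exp s (err2 s1 s2) <=
   noise_exp s (fun z1 z2 z3 => err_ind g1 g2 g21m g21s s1 s2 z1 z2 z3))%E.
Proof.
have e0 z : (0 <= err2 s1 s2 z)%E by rewrite lee_fin.
have -> : gauss_exp s (err2 s1 s2) =
    noise_exp s (fun _ z2 (_ : ms.-tuple R) => err2 s1 s2 z2).
  rewrite /noise_exp gauss_exp_cst; last by do 2 apply: gauss_exp_ge0 => ?.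
  by apply: eq_gauss_exp => z; rewrite gauss_exp_cst.
apply: le_noise_exp => //.
- by apply: measurable_err2; exact: measurableT_comp.
- exact: measurable_err_ind.
- move=> z1 z2 z3; rewrite /err2 /err_ind.
  by case: (decBS _ _ != _); rewrite ?orbT//; case: ifP; rewrite ?lee_fin.
Qed.

Lemma noise_exp_err1_le s (s1 : 'I_(M1 c)) (s2 : 'I_(M2 c)) :
  (gauss_exp s (fun z2 => gauss_exp s (fun z3 =>
     gauss_exp s (fun z1 => err1 s1 s2 z1 z2 z3))) <=
   noise_exp s (fun z1 z2 z3 => err_ind g1 g2 g21m g21s s1 s2 z1 z2 z3))%E.
Proof.
have m1 : measurable_fun setT (fun p : T3 => p.1.1) by exact: measurableT_comp.
have m2 : measurable_fun setT (fun p : T3 => p.1.2) by exact: measurableT_comp.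
have me : measurable_fun setT (fun p : T3 => err1 s1 s2 p.1.1 p.1.2 p.2).
  exact: measurable_err1.
have e0 z1 z2 z3 : (0 <= err1 s1 s2 z1 z2 z3)%E by rewrite lee_fin.
rewrite -(noise_exp_rot R s n ms (err1 s1 s2))//; apply: le_noise_exp => //.
- exact: measurable_err_ind.
- move=> z1 z2 z3; rewrite /err1 /err_ind.
  by case: (decM2 _ _ != _) => //=; case: ifP; rewrite ?lee_fin.
Qed.

End CodeConverse.

(** At full power the noise and signal energies add up to [t ^+ 2], so the quadratic terms
    contribute exactly the [n / 2] of the left side. [Mb] is the size of the decoded codebook and
    [Ma] that of the codebook averaged over. *)
Lemma weak_converse_arith (R : realType) (Ma Mb L n v s t g P eps : R) :
  0 < Ma -> 0 < Mb -> 0 < t -> t ^+ 2 = s ^+ 2 + g ^+ 2 * P ->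
  Ma * (Mb * (L + n / 2)) <= L * (eps * Ma * Mb) +
    (Ma * (Mb * (n * v) + Mb * n * s ^+ 2 / (2 * t ^+ 2) + Mb) +
     g ^+ 2 / (2 * t ^+ 2) * (n * P * Ma * Mb)) ->
  (1 - eps) * L <= n * v + 1.
Proof.
move=> Ma0 Mb0 t0 t2 H.
have t20 : t ^+ 2 != 0 by rewrite gt_eqF// exprn_gt0.
rewrite -(@ler_pM2l _ (Ma * Mb)) ?mulr_gt0//.
have E : Ma * (Mb * n * s ^+ 2 / (2 * t ^+ 2)) + g ^+ 2 / (2 * t ^+ 2) * (n * P * Ma * Mb) =
    Ma * Mb * (n / 2).
  have -> : s ^+ 2 = t ^+ 2 - g ^+ 2 * P by rewrite t2 addrK.
  by field; rewrite gt_eqF.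
move: H E; set X := Mb * n * s ^+ 2 / (2 * t ^+ 2).
by set Y := _ * (n * P * Ma * Mb); move: X Y; clear; move=> X Y; nra.
Qed.

(** * Weak converse for each of the two links *)

Section RateConverse.
Variables (R : realType) (g1 g2 g21m g21s : R) (n ms : nat) (c : Defs.code R n ms).
Hypothesis mc : code_measurable c.
Variables (s t P eps : R).
Hypotheses (s0 : 0 < s) (st : s <= t).
Hypothesis herr : (\sum_(s1 < M1 c) \sum_(s2 < M2 c)
   noise_exp s (fun z1 z2 z3 => err_ind g1 g2 g21m g21s s1 s2 z1 z2 z3) <=
   (eps * (M1 c)%:R * (M2 c)%:R)%:E)%E.

Let Ma0 : 0 < (M1 c)%:R :> R.
Proof. by rewrite ltr0n codebook1_gt0. Qed.
Let Mb0 : 0 < (M2 c)%:R :> R.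
Proof. by rewrite ltr0n codebook2_gt0. Qed.
Let t0 : 0 < t := lt_le_trans s0 st.
Let lnst : 0 <= ln (t / s).
Proof. by rewrite ln_ge0// ler_pdivlMr// mul1r. Qed.

Let noise0 s1 s2 : (0 <= noise_exp s (fun z1 z2 z3 =>
  err_ind (c := c) g1 g2 g21m g21s s1 s2 z1 z2 z3))%E.
Proof.
by do 3 apply: gauss_exp_ge0 => ?; rewrite /err_ind; case: ifP; rewrite ?lee_fin.
Qed.

(** For each fixed [s1] the map [decBS s1] is an ordinary decoder for the codewords [g2 * X2]; the
    resulting bounds are summed over [s1]. *)
Lemma uplink_converse : t ^+ 2 = s ^+ 2 + g2 ^+ 2 * P ->
  \sum_(s2 < M2 c) \sum_(i < n) tnth (encX2 s2) i ^+ 2 <= n%:R * P * (M2 c)%:R ->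
  (1 - eps) * ln (M2 c)%:R <= n%:R * ln (t / s) + 1.
Proof.
move=> t2 hP; set L := ln (M2 c)%:R.
have L0 : 0 <= L by rewrite ln_ge0// ler1n codebook2_gt0.
set S := \sum_(s2 < M2 c) _ in hP.
pose A : R := (M2 c)%:R * (n%:R * ln (t / s)) +
   (M2 c)%:R * n%:R * s ^+ 2 / (2 * t ^+ 2) + (M2 c)%:R.
pose B : R := g2 ^+ 2 / (2 * t ^+ 2).
have B0 : 0 <= B by rewrite divr_ge0 ?sqr_ge0// mulr_ge0// sqr_ge0.
have step s1 : (((M2 c)%:R * (L + n%:R / 2))%:E <=
    L%:E * (\sum_(s2 < M2 c) noise_exp s (fun z1 z2 z3 =>
      err_ind g1 g2 g21m g21s s1 s2 z1 z2 z3)) + (A + B * S)%:E)%E.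
  have mdec s2 : measurable_fun setT (fun y => decBS (c := c) s1 y == s2).
    by apply: (measurable_decBS _ _ _ _ mc); exact: measurable_id.
  have := gaussian_fano R s t n (M2 c)
    (fun s2 => [tuple g2 * tnth (encX2 s2) i | i < n]) (decBS s1) s0 st mdec.
  move=> /le_trans; apply; apply: leeD.
    apply: lee_wpmul2l => //; apply: lee_sum => s2 _.
    rewrite (_ : gauss_exp _ _ = gauss_exp s (err2 R g2 n ms c s1 s2)).
      exact: noise_exp_err2_le.
    by apply: eq_gauss_exp => z; rewrite /err2 sigY2E.
  rewrite lee_fin le_eqVlt; apply/orP; left; apply/eqP.
  have -> : \sum_(m < M2 c) \sum_(i < n)
      tnth [tuple g2 * tnth (encX2 m) i | i < n] i ^+ 2 = g2 ^+ 2 * S.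
    rewrite mulr_sumr; apply: eq_bigr => m _; rewrite mulr_sumr.
    by apply: eq_bigr => i _; rewrite tnth_mktuple exprMn.
  by rewrite /A /B mulrDl mulrAC; ring.
have : (\sum_(s1 < M1 c) ((M2 c)%:R * (L + n%:R / 2))%:E <= \sum_(s1 < M1 c)
    (L%:E * (\sum_(s2 < M2 c) noise_exp s (fun z1 z2 z3 =>
      err_ind g1 g2 g21m g21s s1 s2 z1 z2 z3)) + (A + B * S)%:E))%E.
  by apply: lee_sum => s1 _; exact: step.
rewrite big_split/= -ge0_sume_distrr; last by move=> s1 _; exact: sume_ge0.
rewrite !sumEFin !sumr_const card_ord -[X in (X%:E <= _)%E]mulr_natl.
rewrite -[(A + B * S) *+ _]mulr_natl => H.
have {}H : (((M1 c)%:R * ((M2 c)%:R * (L + n%:R / 2)))%:E <=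
    ((L * (eps * (M1 c)%:R * (M2 c)%:R)) + (M1 c)%:R * (A + B * S))%:E)%E.
  apply: (le_trans H); rewrite EFinD (EFinM L) leeD2r//.
  exact: lee_wpmul2l.
rewrite lee_fin in H.
apply: (@weak_converse_arith _ (M1 c)%:R (M2 c)%:R _ _ _ s t g2 P) => //.
apply: (le_trans H); rewrite lerD2l mulrDr lerD2l mulrCA ler_wpM2l//.
by rewrite mulrC (mulrAC _ (M1 c)%:R) ler_wpM2r.
Qed.

(** BS hears only [sigY2], which is determined by [s2] and [z2]. With these fixed, [X1] is a
    deterministic codeword for [s1], whatever the feedback; the bound is then averaged over [z3],
    [z2] and [s2]. *)
Lemma downlink_converse : t ^+ 2 = s ^+ 2 + g1 ^+ 2 * P ->
  (\sum_(s1 < M1 c) \sum_(s2 < M2 c)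
     noise_exp s (fun z1 z2 (z3 : ms.-tuple R) => pow1 g2 s1 s2 z2) <=
     (n%:R * P * (M1 c)%:R * (M2 c)%:R)%:E)%E ->
  (1 - eps) * ln (M1 c)%:R <= n%:R * ln (t / s) + 1.
Proof.
move=> t2 hP; set L := ln (M1 c)%:R.
have L0 : 0 <= L by rewrite ln_ge0// ler1n codebook1_gt0.
pose A : R := (M1 c)%:R * (n%:R * ln (t / s)) +
   (M1 c)%:R * n%:R * s ^+ 2 / (2 * t ^+ 2) + (M1 c)%:R.
pose B : R := g1 ^+ 2 / (2 * t ^+ 2).
have s20 : 0 <= s ^+ 2 by exact: sqr_ge0.
have t20 : 0 <= 2 * t ^+ 2 by rewrite mulr_ge0// sqr_ge0.
have B0 : 0 <= B by rewrite divr_ge0 ?sqr_ge0.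
have A0 : 0 <= A.
  apply: addr_ge0 => //; apply: addr_ge0; first by rewrite mulr_ge0// mulr_ge0.
  by rewrite divr_ge0// mulr_ge0// mulr_ge0.
have pow0 s1 s2 z2 : (0 <= pow1 (c := c) g2 s1 s2 z2)%E.
  by rewrite lee_fin sumr_ge0// => i _; exact: sqr_ge0.
have mpow s1 s2 : measurable_fun setT (pow1 (c := c) g2 s1 s2).
  apply/measurable_EFinP; apply: measurable_sum => i; apply: measurable_funX.
  exact: (measurable_sigX1 _ _ _ _ _ mc _ _ id).
have noiseP s1 s2 : noise_exp s (fun z1 z2 (z3 : ms.-tuple R) =>
    pow1 (c := c) g2 s1 s2 z2) = gauss_exp s (pow1 g2 s1 s2).
  rewrite /noise_exp gauss_exp_cst; last by do 2 apply: gauss_exp_ge0 => ?.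
  by apply: eq_gauss_exp => z; rewrite gauss_exp_cst.
pose e s1 s2 z1 z2 z3 := err1 R g1 g2 g21m g21s n ms c s1 s2 z1 z2 z3.
have e0 s1 s2 z1 z2 z3 : (0 <= e s1 s2 z1 z2 z3)%E by rewrite lee_fin.
(* The part of the bound free of errors. Its codeword energy still varies with [z2] through the
   feedback, but not with [z3]. *)
pose K s2 z2 := (A%:E + B%:E * \sum_(s1 < M1 c) pow1 (c := c) g2 s1 s2 z2)%E.
have K0 s2 z2 : (0 <= K s2 z2)%E.
  by rewrite adde_ge0// mule_ge0// ?lee_fin// sume_ge0.
have a0 : 0 <= (M1 c)%:R * (L + n%:R / 2) by rewrite mulr_ge0// addr_ge0.
have step s2 z2 z3 : (((M1 c)%:R * (L + n%:R / 2))%:E <=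
    L%:E * (\sum_(s1 < M1 c) gauss_exp s (fun z1 => e s1 s2 z1 z2 z3)) + K s2 z2)%E.
  (* The known interference and side-channel output become part of the decoder. *)
  pose dec y := decM2 c (addt R n [tuple g21m * tnth (encX2 s2) i | i < n] y,
    sigY3 g21s s2 z3).
  have mdec m : measurable_fun setT (fun y => dec y == m).
    apply: (measurable_decM2 _ _ _ _ mc); apply: measurable_fun_pair => //.
    by apply: measurable_addt => //; exact: measurable_cst.
  have := gaussian_fano R s t n (M1 c)
    (fun s1 => [tuple g1 * sigX1 g2 s1 s2 z2 i | i < n]) dec s0 st mdec.
  move=> /le_trans; apply; apply: leeD.
    apply: lee_wpmul2l => //; apply: lee_sum => s1 _.
    rewrite (_ : gauss_exp _ _ = gauss_exp s (fun z1 => e s1 s2 z1 z2 z3))//.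
    by apply: eq_gauss_exp => z; rewrite /e /err1 sigY1E.
  rewrite /K /pow1 sumEFin -EFinM -EFinD lee_fin le_eqVlt; apply/orP; left; apply/eqP.
  have -> : \sum_(m < M1 c) \sum_(i < n)
      tnth [tuple g1 * sigX1 g2 m s2 z2 i | i < n] i ^+ 2 =
      g1 ^+ 2 * \sum_(m < M1 c) \sum_(i < n) sigX1 g2 m s2 z2 i ^+ 2.
    rewrite mulr_sumr; apply: eq_bigr => m _; rewrite mulr_sumr.
    by apply: eq_bigr => i _; rewrite tnth_mktuple exprMn.
  by rewrite /A /B mulrDl mulrAC; ring.
have avg s2 : (((M1 c)%:R * (L + n%:R / 2))%:E <=
    L%:E * (\sum_(s1 < M1 c) noise_exp s (fun z1 z2 z3 =>
      err_ind g1 g2 g21m g21s s1 s2 z1 z2 z3)) +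
    (A%:E + B%:E * \sum_(s1 < M1 c) gauss_exp s (pow1 g2 s1 s2)))%E.
  have me1 s1 : measurable_fun setT (fun q : n.-tuple R * ms.-tuple R =>
      gauss_exp s (fun z1 => e s1 s2 z1 q.1 q.2)).
    apply: (measurable_gauss_exp R _ _ s n (fun p : (n.-tuple R * ms.-tuple R) *
      n.-tuple R => e s1 s2 p.2 p.1.1 p.1.2)) => //.
    by apply: (measurable_err1 _ _ _ _ _ _ _ _ mc) => //; exact: measurableT_comp.
  have avg3 z2 : (((M1 c)%:R * (L + n%:R / 2))%:E <=
      L%:E * (\sum_(s1 < M1 c) gauss_exp s (fun z3 =>
        gauss_exp s (fun z1 => e s1 s2 z1 z2 z3))) + K s2 z2)%E.
    rewrite -(gauss_exp_cst R s ms (K s2 z2))//.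
    apply: gauss_exp_affine_bound => //.
    - move=> s1; exact: (measurable_fun_section2 _ _ _ _ _ _ _ z2 (me1 s1)).
    - by move=> s1 z; exact: gauss_exp_ge0.
  have mK : measurable_fun setT (K s2).
    apply: emeasurable_funD => //; apply: measurable_funeM.
    by apply: emeasurable_sum.
  have := gauss_exp_affine_bound R s n (M1 c) _ _
    (fun s1 z2 => gauss_exp s (fun z3 => gauss_exp s (fun z1 => e s1 s2 z1 z2 z3)))
    (K s2) a0 L0.
  move=> /(_ _ _ mK (K0 s2) avg3) H.
  have {}H := H _ _; apply: (le_trans (H _ _)).
  - move=> s1; apply: (measurable_gauss_exp R _ _ s ms (fun q : n.-tuple R * ms.-tuple R =>
      gauss_exp s (fun z1 => e s1 s2 z1 q.1 q.2))) => //.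
    by move=> p; exact: gauss_exp_ge0.
  - by move=> s1 z; do 2 apply: gauss_exp_ge0 => ?.
  apply: leeD.
    apply: lee_wpmul2l => //; apply: lee_sum => s1 _; exact: noise_exp_err1_le.
  rewrite /K gauss_expD//.
  - rewrite gauss_exp_cst ?lee_fin// gauss_expZ//.
    + by rewrite gauss_exp_sum.
    + exact: emeasurable_sum.
    + by move=> z; exact: sume_ge0.
  - by apply: measurable_funeM; exact: emeasurable_sum.
  - by move=> z; rewrite mule_ge0// sume_ge0.
have : (\sum_(s2 < M2 c) ((M1 c)%:R * (L + n%:R / 2))%:E <= \sum_(s2 < M2 c)
    (L%:E * (\sum_(s1 < M1 c) noise_exp s (fun z1 z2 z3 =>
      err_ind g1 g2 g21m g21s s1 s2 z1 z2 z3)) +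
    (A%:E + B%:E * \sum_(s1 < M1 c) gauss_exp s (pow1 g2 s1 s2))))%E.
  by apply: lee_sum => s2 _; exact: avg.
rewrite !big_split/= -ge0_sume_distrr; last by move=> s2 _; exact: sume_ge0.
rewrite -ge0_sume_distrr; last by move=> s2 _; apply: sume_ge0 => *; exact: gauss_exp_ge0.
rewrite !sumEFin !sumr_const card_ord -[X in (X%:E <= _)%E]mulr_natl.
rewrite -[A *+ _]mulr_natl exchange_big/= [X in (_ + (_ + _ * X))%E]exchange_big/= => H.
have {}H : (((M2 c)%:R * ((M1 c)%:R * (L + n%:R / 2)))%:E <=
    ((L * (eps * (M1 c)%:R * (M2 c)%:R)) + ((M2 c)%:R * A +
      B * (n%:R * P * (M1 c)%:R * (M2 c)%:R)))%:E)%E.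
  apply: (le_trans H); rewrite EFinD (EFinM L) leeD//; first exact: lee_wpmul2l.
  rewrite EFinD (EFinM B) leeD2l//; apply: lee_wpmul2l => //.
  under eq_bigr do under eq_bigr do rewrite -noiseP.
  exact: hP.
rewrite lee_fin in H.
(* The codebook of [s1] is now the decoded one, so the two sizes exchange roles. *)
apply: (@weak_converse_arith _ (M2 c)%:R (M1 c)%:R _ _ _ s t g1 P) => //.
by move: H; rewrite -!(mulrAC _ (M1 c)%:R (M2 c)%:R).
Qed.

End RateConverse.

(** * Capacity region *)

Section Capacity.
Variable R : realType.

(** Since [(t / s) ^+ 2] is 1 plus the SNR, [ln (t / s)] is the capacity in nats per channel use. A
    rate above it contradicts the converse for small [eps] and large [n]. *)
Lemma rate_le_capC (Wm s t g P r : R) : 0 < Wm -> 0 < s -> s <= t ->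
  t ^+ 2 = s ^+ 2 + g ^+ 2 * P -> 0 <= r ->
  (forall eps : R, 0 < eps -> exists N : nat, forall n : nat, (N <= n)%N ->
    exists M : nat, n%:R * r / (2 * Wm) <= log2 M%:R /\
      (1 - eps) * ln M%:R <= n%:R * ln (t / s) + 1) ->
  r <= capC Wm (SNR g P s).
Proof.
move=> Wm0 s0 st t2 r0 H; have t0 := lt_le_trans s0 st.
have ln20 : 0 < ln 2 :> R by rewrite ln_gt0// ltr1n.
set v := ln (t / s) in H.
have v0 : 0 <= v by rewrite ln_ge0// ler_pdivlMr// mul1r.
have -> : capC Wm (SNR g P s) = 2 * Wm * v / ln 2.
  rewrite /capC /log2 (_ : 1 + _ = (t / s) ^+ 2).
    by rewrite lnXn ?divr_gt0// -/v -mulr_natl; ring.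
  by rewrite /SNR expr_div_n t2; field; rewrite gt_eqF.
(* The rate in nats per main-channel use. *)
pose rho := r * ln 2 / (2 * Wm).
have Wm2 : 0 < 2 * Wm by rewrite mulr_gt0.
suff : rho <= v by rewrite ler_pdivrMr// ler_pdivlMr// (mulrC v).
rewrite leNgt; apply/negP => vr.
have rho0 : 0 < rho by exact: le_lt_trans vr.
(* With this choice [eps * rho] is a quarter of the excess [rho - v]; the block length below makes
   the additive 1 cost less than another quarter per use. *)
pose eps := (rho - v) / (4 * rho).
have e0 : 0 < eps by rewrite divr_gt0 ?subr_gt0// mulr_gt0.
have e1 : eps < 1 by rewrite /eps ltr_pdivrMr; [lra|rewrite mulr_gt0].
have [N HN] := H eps e0.
pose k := (Num.truncn (4 / (rho - v))).+1.
have [M [h1 h2]] := HN (maxn N k) (leq_maxl _ _).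
set n := maxn N k in h1 h2.
have n0 : 4 / (rho - v) < n%:R.
  apply: lt_le_trans (truncnS_gt _) _; by rewrite ler_nat leq_maxr.
have rv : 0 < rho - v by rewrite subr_gt0.
have nv : 4 < n%:R * (rho - v) by rewrite -ltr_pdivrMr.
have h3 : n%:R * rho <= ln M%:R.
  move: h1; rewrite /log2 ler_pdivlMr// => /(le_trans _); apply.
  by rewrite /rho le_eqVlt; apply/orP; left; apply/eqP; ring.
have h4 : (1 - eps) * (n%:R * rho) <= n%:R * v + 1.
  by apply: le_trans h2; rewrite ler_wpM2l// subr_ge0 ltW.
have : eps * rho = (rho - v) / 4 by rewrite /eps; field; rewrite gt_eqF.
move: h4; have -> : (1 - eps) * (n%:R * rho) = n%:R * rho - n%:R * (eps * rho) by ring.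
by move=> h4 E; rewrite E in h4; lra.
Qed.

Lemma exists_output_std (s g P : R) : 0 < s -> 0 < P ->
  exists t, s <= t /\ t ^+ 2 = s ^+ 2 + g ^+ 2 * P.
Proof.
move=> s0 P0; exists (Num.sqrt (s ^+ 2 + g ^+ 2 * P)).
have h : 0 <= g ^+ 2 * P by rewrite mulr_ge0 ?sqr_ge0 ?ltW.
rewrite sqr_sqrtr ?addr_ge0 ?sqr_ge0//; split => //.
by rewrite -{1}(ger0_norm (ltW s0)) -sqrtr_sqr ler_wsqrtr// lerDl.
Qed.

(** The two bounds cut out a closed set, so it is enough to prove them for achievable pairs. *)
Lemma capacity_region_le (Wm Ws s P1 P2 g1 g2 g21m g21s : R) (r : R * R) :
  0 < Wm -> 0 < s -> 0 < P1 -> 0 < P2 ->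
  capacity_region Wm Ws s P1 P2 g1 g2 g21m g21s r ->
  r.1 <= capC Wm (SNR g1 P1 s) /\ r.2 <= capC Wm (SNR g2 P2 s).
Proof.
move=> Wm0 s0 P10 P20.
set B := [set r : R * R | r.1 <= capC Wm (SNR g1 P1 s)] `&`
         [set r : R * R | r.2 <= capC Wm (SNR g2 P2 s)].
have cB : closed B.
  apply: closedI.
    apply: (@closed_comp _ _ (@fst R R) [set x | x <= _]); last exact: closed_le.
    by move=> x _; exact: cvg_fst.
  apply: (@closed_comp _ _ (@snd R R) [set x | x <= _]); last exact: closed_le.
  by move=> x _; exact: cvg_snd.
suff AB : achievable Wm Ws s P1 P2 g1 g2 g21m g21s `<=` B.
  by move=> /(closureS AB); rewrite -(closure_id B).1.
move=> [r1 r2] [/= r10 [r20 H]]; split => /=.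
- have [t [st t2]] := exists_output_std s g1 P1 s0 P10.
  apply: (rate_le_capC _ s t) => // eps e0; have [N HN] := H eps e0.
  exists N => n /HN[ms [_ [c [_ [mc [h1 [_ [hp [_ he]]]]]]]]].
  exists (M1 c); split => //.
  exact: (downlink_converse _ _ _ _ _ _ _ _ mc _ _ _ _ s0 st he t2 hp).
- have [t [st t2]] := exists_output_std s g2 P2 s0 P20.
  apply: (rate_le_capC _ s t) => // eps e0; have [N HN] := H eps e0.
  exists N => n /HN[ms [_ [c [_ [mc [_ [h2 [_ [hp he]]]]]]]]].
  exists (M2 c); split => //.
  apply: (uplink_converse _ _ _ _ _ _ _ _ mc _ _ _ _ s0 st he t2).
  (* The energy spent on the main channel is at most the total energy of M1 over both channels. *)
  apply: le_trans hp; apply: ler_sum => s2 _; rewrite lerDl sumr_ge0// => i _.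
  exact: sqr_ge0.
Qed.

(** The hypothesis says [1 + x <= 2 * (1 + y)], and a factor 2 inside the logarithm is worth one bit
    per unit of bandwidth. *)
Lemma capC_half (Wm x y : R) : 0 < Wm -> 0 <= x -> (x - 1) / 2 <= y ->
  capC Wm x - Wm <= capC Wm y.
Proof.
move=> Wm0 x0 xy; have ln20 : 0 < ln 2 :> R by rewrite ln_gt0// ltr1n.
rewrite /capC -[X in _ - X]mulr1 -mulrBr ler_pM2l// /log2.
rewrite -(@ler_pM2r _ (ln 2))// mulrBl mul1r !divfK ?gt_eqF//.
rewrite -ln_div ?posrE//; last by lra.
by rewrite ler_ln ?posrE; lra.
Qed.

(** Concavity of [ln]: [1 + y / W] is the mean of [1 + y] and 1 with weight [W^-1] on the former. *)
Lemma ln_scale (W y : R) : 1 <= W -> 0 <= y -> ln (1 + y) <= W * ln (1 + y / W).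
Proof.
move=> W1 y0; have W0 : 0 < W by lra.
have i0 : 0 <= W^-1 by rewrite invr_ge0 ltW.
have i1 : W^-1 <= 1 by rewrite invf_le1.
have := @concave_ln R (Itv01 i0 i1) (1 + y) 1 _ _.
rewrite !convRE ln1 /= /unstable.onem mulr0 addr0 mulr1 => H.
have -> : 1 + y / W = W^-1 * (1 + y) + (1 - W^-1) by ring.
rewrite mulrC -ler_pdivrMr// mulrC; apply: H => //; lra.
Qed.

Lemma capC_scale (Wm W y : R) : 0 < Wm -> 1 <= W -> 0 <= y ->
  capC Wm y <= W * capC Wm (y / W).
Proof.
move=> Wm0 W1 y0; have ln20 : 0 < ln 2 :> R by rewrite ln_gt0// ltr1n.
by rewrite /capC /log2 (mulrCA W) ler_pM2l// mulrA ler_pM2r ?invr_gt0// ln_scale.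
Qed.

Lemma SNR_ge0 (g P s : R) : 0 < P -> 0 <= SNR g P s.
Proof. by move=> P0; rewrite divr_ge0 ?sqr_ge0// mulr_ge0 ?sqr_ge0// ltW. Qed.

End Capacity.

(* Wm, Ws: bandwidths; sig: noise standard deviation (variance sig^2);
   P1, P2: power constraints; g1 = gamma_1, g2 = gamma_2,
   g21m = gamma^m_21, g21s = gamma^s_21. *)
Theorem theorem3 (R : realType) (Wm Ws sig P1 P2 g1 g2 g21m g21s : R) :
  0 < Wm -> 0 < Ws -> 0 < sig -> 0 < P1 -> 0 < P2 ->
  let W := Ws / Wm in
  let SNR1 := SNR g1 P1 sig in
  let SNR2 := SNR g2 P2 sig in
  let INR := SNR g21m P2 sig in
  let SNRs := SNR g21s P2 sig in
  let CC := capacity_region Wm Ws sig P1 P2 g1 g2 g21m g21s in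
  let gap := (Wm + Ws) / 2 in
  (* (1) *)
  (1 <= W -> SNR2 <= SNRs ->
   forall R1 R2 : R, CC (R1, R2) ->
     R_DC Wm Ws SNR1 SNR2 SNRs (R1 - gap, R2 - gap)) /\
  (* (2) *)
  ((exists k : nat, (0 < k)%N /\ W = k%:R) ->
   (1 + 2 / (Num.sqrt 2 - 1)) * (INR - 2) <= SNRs ->
   forall R1 R2 : R, CC (R1, R2) ->
     R_EC Wm SNR1 SNR2 SNRs INR (R1 - gap, R2 - gap)).
Proof.
move=> Wm0 Ws0 s0 P10 P20 W SNR1 SNR2 INR SNRs CC gap.
have S1 : 0 <= SNR1 by exact: SNR_ge0.
have S2 : 0 <= SNR2 by exact: SNR_ge0.
have S3 : 0 <= SNRs by exact: SNR_ge0.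
have S4 : 0 <= INR by exact: SNR_ge0.
have outer R1 R2 : CC (R1, R2) -> R1 <= capC Wm SNR1 /\ R2 <= capC Wm SNR2.
  by move=> /(capacity_region_le _ _ _ _ _ _ _ _ _ _ _ Wm0 s0 P10 P20).
(* For [W] at least 1 the gap covers a loss of [Wm], which is what [capC_half] charges. *)
have gapW : 1 <= W -> Wm <= gap.
  by rewrite /W ler_pdivlMr// mul1r /gap => ?; lra.
split.
(* An equal power split halves both SNRs. On the side channel [capC_scale] removes the bandwidth
   ratio, and its SNR dominates [SNR2]. *)
- move=> W1 S23 R1 R2 /outer[h1 h2]; exists (1 / 2); split; first by lra.
  have {}gapW := gapW W1.
  rewrite /= le_min; split; first by lra.
  apply/andP; split.
    have := capC_scale R Wm W (1 / 2 * SNRs) Wm0 W1.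
    have := capC_half R Wm SNR2 (1 / 2 * SNRs) Wm0 S2.
    by rewrite -/W; lra.
  have := capC_half R Wm SNR2 ((1 - 1 / 2) * SNR2) Wm0 S2; lra.
- move=> [k [k0 Wk]] hS R1 R2 /outer[h1 h2].
  have {}gapW : Wm <= gap by apply: gapW; rewrite Wk ler1n.
  set q := Num.sqrt 2 in hS.
  have q2 : q ^+ 2 = 2 by rewrite sqr_sqrtr.
  have q1 : 1 < q by rewrite -(@ltr_pXn2r _ 2) ?nnegrE ?sqrtr_ge0// q2 expr1n ltr1n.
  (* This [K] makes [(1 + K) ^+ 2] equal to 2, so the uplink SNR is exactly halved. *)
  exists (q - 1); split; first by lra.
  rewrite /= (_ : 1 + (q - 1) = q); last by ring.
  rewrite q2; split; last first.
    have := capC_half R Wm SNR2 (SNR2 / 2) Wm0 S2; lra.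
  (* The constant of the hypothesis is the inverse of [(q - 1) ^+ 2], that is of [K ^+ 2]. *)
  have hI : INR - 2 <= (q - 1) ^+ 2 * SNRs.
    have E : (q - 1) ^+ 2 * (1 + 2 / (q - 1)) = 1.
      rewrite (_ : _ * _ = q ^+ 2 - 1); first by rewrite q2; lra.
      by field; lra.
    by have := ler_wpM2l (sqr_ge0 (q - 1)) hS; rewrite mulrA E mul1r.
  set a := 1 + _.
  have a0 : 0 < a by rewrite ltr_pwDl// divr_ge0// mulr_ge0 ?sqr_ge0.
  (* The residual interference is at most [a], so the downlink keeps at least half of [SNR1]. *)
  have ab : INR / 2 <= a by rewrite /a; lra.
  suff : capC Wm SNR1 - Wm <= capC Wm (SNR1 * a / (a + INR / 2)) by lra.
  apply: capC_half => //.
  rewrite ler_pdivlMr; last by lra.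
  clearbody a SNR1 INR; nra.
Qed.
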